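(* Let $y$ be an algebraic function of $N$ complex variables $x_1,\dots,x_N$ whose monodromy group is unsolvable (i.e. not solvable). Then $y$ cannot be represented by compositions of rational functions and radicals.
   Context: An algebraic function $y(x)$ of $x=(x_1,\dots,x_N)$ is the multivalued function defined by an irreducible equation $P_n y^n+\dots+P_0=0$ over $\mathbb{C}(x_1,\dots,x_N)$, with $P_i$ complex polynomials in $x$ and $P_n\not\equiv0$. Let $J$ be the discriminant of the equation and $\Sigma=\{P_nJ=0\}\subset\mathbb{C}^N$. At $x_0\in\mathbb{C}^N\setminus\Sigma$ the function $y$ has exactly $n$ germs $y_1,\dots,y_n$ (the germs of analytic functions satisfying the equation). The monodromy group of $y$ is the group of all permutations of $\{y_1,\dots,y_n\}$ induced by analytic continuation along loops in $\mathbb{C}^N\setminus\Sigma$ based at $x_0$; up to isomorphism it does not depend on $x_0$. Representability: $y$ is represented by compositions of rational functions and radicals if there are a point $a\in\mathbb{C}^N$ and a finite sequence $g_1,\dots,g_k$ of germs of analytic functions at $a$ such that $g_k$ is a germ of $y$ at $a$ and each $g_i$ either is a germ of a rational function of $x_1,\dots,x_N$, or is a sum, difference, product or quotient (with divisor not identically zero) of germs $g_j$, $g_l$ with $j,l<i$, or satisfies $g_i^q=g_j$ for some $j<i$ and some integer $q\ge1$. *)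

(* Defs.v *)
From HB Require Import structures.
From mathcomp Require Import all_boot all_order all_algebra.
From mathcomp Require Import all_fingroup all_solvable finmap complex zify lra.
From mathcomp Require Import all_classical all_reals all_analysis.
(* The notations of mpoly clash with those of mathcomp-analysis, so that the
   polynomial ring in N variables is written mpoly N C. *)
From mathcomp Require Import -(notations) mpoly.

Set Implicit Arguments.
Unset Strict Implicit.
Unset Printing Implicit Defensive.
Import Order.TTheory GRing.Theory Num.Theory.
Import numFieldTopology.Exports numFieldNormedType.Exports.

Local Open Scope classical_set_scope.
Local Open Scope ring_scope.

HB.instance Definition _ (R : realType) := NormedModule.copy R[i] R[i]^o.

Section Germs.
Variables (R : realType) (N : nat).
Local Notation C := R[i].
Local Notation V := 'rV[C]_N.

Definition finite_subsets (I : choiceType) : set_system {fset I} :=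
  filter_from setT (fun A => [set B | fsubset A B]).

Global Instance finite_subsets_filter (I : choiceType) :
  ProperFilter (@finite_subsets I).
Proof.
eapply filter_from_proper; last by move=> A _; exists A; rewrite /= fsubset_refl.
apply: filter_fromT_filter; first by exists fset0.
by move=> A B; exists (A `|` B)%fset => P /=; rewrite fsubUset => /andP[].
Qed.

(* Power series in N variables: the family of monomials indexed by the
   multi-indices m : multinom N is summed unconditionally (equivalently,
   absolutely) at every point of some neighbourhood of a. *)
Definition analytic_at (a : V) (f : V -> C) : Prop :=
  exists c : multinom N -> C, \forall x \near a,
    (fun B : {fset multinom N} => \sum_(m <- B) c m * mmap1 ((x - a) 0) m)
      @ @finite_subsets (multinom N) --> f x.

(* Germs are handled through representatives: two functions have the same germ
   at a when they agree on a neighbourhood of a. *)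
Definition germ_eq (a : V) (f g : V -> C) : Prop := \forall x \near a, f x = g x.

Local Notation "p .@[ x ]" := (meval (fun i => x 0 i) p).

(* P : {poly mpoly N C} is P_n Y^n + ... + P_0; irreducibility is over the field
   of rational functions, not over mpoly N C. *)
Definition irreducible_equation (P : {poly mpoly N C}) : Prop :=
  irreducible_poly (map_poly (@tofrac (mpoly N C)) P).

Definition specialize (P : {poly mpoly N C}) (x : V) : {poly C} :=
  map_poly (fun p => p.@[x]) P.

(* The germs of analytic functions at a that solve P = 0. *)
Definition germ_of (P : {poly mpoly N C}) (a : V) (f : V -> C) : Prop :=
  analytic_at a f /\ \forall x \near a, (specialize P x).[f x] = 0.

Definition degree (P : {poly mpoly N C}) : nat := (size P).-1.

(* The discriminant J of P = P_n Y^n + ... + P_0, characterised by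
   P_n J = (-1)^(n(n-1)/2) Res(P, P'); existence and uniqueness of J for
   n >= 1 are discriminantP and discriminant_unique below. *)
Definition discriminant (P : {poly mpoly N C}) : mpoly N C :=
  xget 0 [set J | lead_coef P * J
                  = (-1) ^+ 'C(degree P, 2) * resultant P P^`()].

Lemma mpoly_natr_neq0 n : n.+1%:R != 0 :> mpoly N C.
Proof.
rewrite -(mpolyC_nat N _ n.+1) mpolyC_eq0.
by rewrite pnatr_eq0.
Qed.

Lemma discriminantP (P : {poly mpoly N C}) : (1 < size P)%N ->
  lead_coef P * discriminant P = (-1) ^+ 'C(degree P, 2) * resultant P P^`().
Proof.
move=> sP; apply: (@xgetPex _ 0 [set J | lead_coef P * J = _]).
suff [K ->] : exists K, resultant P P^`() = lead_coef P * K.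
  by exists ((-1) ^+ 'C(degree P, 2) * K); rewrite /= mulrCA.
have [n sPn] : exists n, size P = n.+2 by case: (size P) sP => [|[|n]] // _; exists n.
have lP : lead_coef P = P`_n.+1 by rewrite lead_coefE sPn.
have dPn : (P^`())`_n = lead_coef P * n.+1%:R.
  by rewrite coef_deriv lP mulr_natr.
have sP' : size P^`() = n.+1.
  apply/eqP; rewrite eqn_leq; apply/andP; split.
    rewrite -ltnS -sPn; apply: lt_size_deriv.
    by rewrite -size_poly_gt0 sPn.
  rewrite ltnNge; apply/negP => /leq_sizeP /(_ n (leqnn n)).
  apply/eqP; rewrite dPn mulf_neq0 ?mpoly_natr_neq0 // lead_coef_eq0.
  by rewrite -size_poly_gt0 sPn.
have jlt : (n + n < (size P^`()).-1 + (size P).-1)%N by rewrite sP' sPn /= addnS.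
pose j := Ordinal jlt.
have entry i : exists K, Sylvester_mx P P^`() i j = lead_coef P * K.
  rewrite Sylvester_mxE /=; case: (fintype.split i) => -[k kn] /=.
    rewrite sP' /= in kn.
    have [e|ne] := eqVneq (k.+1) n.
      have -> : (n + n - k = n.+1)%N by lia.
      by exists (k <= n + n)%N%:R; rewrite lP mulr_natr.
    exists 0; rewrite nth_default ?mul0rn ?mulr0 // sPn.
    by have := ne; have := kn; clear; lia.
  rewrite sPn /= in kn.
  have [e|ne] := eqVneq k n.
    by exists n.+1%:R; rewrite e addnK dPn leq_addr mulr1n.
  exists 0; rewrite nth_default ?mul0rn ?mulr0 // sP'.
  by have := ne; have := kn; clear; lia.
rewrite /resultant (expand_det_col _ j).
have /choice[K HK] := entry.
exists (\sum_i K i * cofactor (Sylvester_mx P P^`()) i j).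
by rewrite mulr_sumr; apply: eq_bigr => i _; rewrite HK mulrA.
Qed.

Lemma discriminant_unique (P : {poly mpoly N C}) (J : mpoly N C) :
  (1 < size P)%N ->
  lead_coef P * J = (-1) ^+ 'C(degree P, 2) * resultant P P^`() ->
  J = discriminant P.
Proof.
move=> sP JE; apply: (@mulfI _ (lead_coef P)); last by rewrite discriminantP.
by rewrite lead_coef_eq0 -size_poly_gt0 ltnW.
Qed.

Definition singular_locus (P : {poly mpoly N C}) : set V :=
  [set x | (lead_coef P * discriminant P).@[x] = 0].

(* y lists, without repetition, all the germs at a that solve P = 0. *)
Definition all_germs_of (P : {poly mpoly N C}) (a : V)
    (y : 'I_(degree P) -> V -> C) : Prop :=
  [/\ forall i, germ_of P a (y i),
      forall i j, germ_eq a (y i) (y j) -> i = j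
    & forall f, germ_of P a f -> exists i, germ_eq a f (y i)].

Arguments all_germs_of P a y : clear implicits.

Definition loop_in (U : set V) (x0 : V) (gam : R -> V) : Prop :=
  [/\ {within `[0, 1], continuous gam}, gam 0 = x0, gam 1 = x0
    & forall t : R, t \in `[0, 1] -> U (gam t)].

(* Analytic continuation along gam of the germ of f at gam 0 to the germ of g at
   gam 1: F t represents the continued germ at gam t, and the germs at nearby
   parameters are restrictions of one another. *)
Definition continues_to (gam : R -> V) (f g : V -> C) : Prop :=
  exists F : R -> V -> C,
    [/\ forall t : R, t \in `[0, 1] -> analytic_at (gam t) (F t),
        forall t : R, t \in `[0, 1] -> \forall s \near t, s \in `[0, 1] ->
          germ_eq (gam s) (F s) (F t),
        germ_eq (gam 0) (F 0) f
      & germ_eq (gam 1) (F 1) g].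

(* A permutation s belongs to the monodromy group when a single loop continues
   every germ y i to y (s i). That this is a group is monodromy_group_set. *)
Definition monodromy_group (P : {poly mpoly N C}) (x0 : V)
    (y : 'I_(degree P) -> V -> C) : {set 'S_(degree P)} :=
  finset (fun s : 'S_(degree P) =>
    `[< exists2 gam, loop_in (~` singular_locus P) x0 gam &
        forall i, continues_to gam (y i) (y (s i)) >]).

Arguments monodromy_group P x0 y : clear implicits.

Lemma monodromy_groupP (P : {poly mpoly N C}) (x0 : V)
    (y : 'I_(degree P) -> V -> C) (s : 'S_(degree P)) :
  reflect (exists2 gam, loop_in (~` singular_locus P) x0 gam &
             forall i, continues_to gam (y i) (y (s i)))
    (s \in monodromy_group P x0 y).
Proof. by rewrite finset.inE; exact: asboolP. Qed.

Lemma within_path_comp (gam : R -> V) (phi : R -> R) (B : set R) :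
  {within `[0, 1], continuous gam} -> continuous phi ->
  (forall t, B t -> phi t \in `[0, 1]) -> {within B, continuous (gam \o phi)}.
Proof.
move=> /subspace_continuousP cg cphi phiB; apply/subspace_continuousP => t Bt.
move=> W /(cg (phi t) (phiB t Bt)) /= nW.
have := cphi t _ nW; rewrite /= !nbhs_simpl /= => nW'.
apply: (@filterS _ (nbhs t)) nW' => s /= + Bs; apply; exact: phiB.
Qed.

Lemma continues_to_comp (gam : R -> V) (F : R -> V -> C) (phi : R -> R) (t : R) :
  continuous phi ->
  (forall t : R, t \in `[0, 1] -> \forall s \near t, s \in `[0, 1] ->
     germ_eq (gam s) (F s) (F t)) ->
  phi t \in `[0, 1] ->
  \forall s \near t, phi s \in `[0, 1] ->
    germ_eq (gam (phi s)) (F (phi s)) (F (phi t)).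
Proof. by move=> cphi cF /cF; exact: cphi. Qed.

Lemma monodromy_group_set (P : {poly mpoly N C}) (x0 : V)
    (y : 'I_(degree P) -> V -> C) :
  ~ singular_locus P x0 -> all_germs_of P x0 y ->
  group_set (monodromy_group P x0 y).
Proof.
move=> Sx0 [ay _ _]; apply/group_setP; split.
  apply/monodromy_groupP; exists (cst x0).
    by split=> //; apply: continuous_subspaceT => t; exact: cvg_cst.
  move=> i; rewrite perm1; exists (fun=> y i); split=> //.
  - by move=> t _; have [] := ay i.
  - by move=> t _; apply: (@filterE _ (nbhs t)) => s _; exact: (@filterE _ (nbhs _)).
  - exact: (@filterE _ (nbhs _)).
  - exact: (@filterE _ (nbhs _)).
move=> s1 s2 /monodromy_groupP[g1 [cg1 g10 g11 g1U] y1].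
move=> /monodromy_groupP[g2 [cg2 g20 g21 g2U] y2].
apply/monodromy_groupP.
pose p1 (u : R) := 2 * u; pose p2 (u : R) := 2 * u - 1.
have cp1 : continuous p1 by move=> u; apply: cvgM; [exact: cvg_cst|exact: cvg_id].
have cp2 : continuous p2.
  by move=> u; apply: cvgB; [exact: cp1|exact: cvg_cst].
have p1I (u : R) : 0 <= u -> u <= 2^-1 -> p1 u \in `[0, 1].
  by rewrite in_itv /= /p1 => ? ?; apply/andP; split; lra.
have p2I (u : R) : 2^-1 <= u -> u <= 1 -> p2 u \in `[0, 1].
  by rewrite in_itv /= /p2 => ? ?; apply/andP; split; lra.
have p1h : p1 2^-1 = 1 by rewrite /p1; lra.
have p2h : p2 2^-1 = 0 by rewrite /p2; lra.
pose gam u := if u <= 2^-1 then g1 (p1 u) else g2 (p2 u).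
have gam2 u : 2^-1 <= u -> gam u = g2 (p2 u).
  rewrite /gam; case: ltgtP => // <- _.
  by rewrite p1h p2h g20 g11.
exists gam.
  split.
  - have -> : [set` `[0, 1]] = [set` `[0, 2^-1]] `|` [set` `[2^-1, 1]] :> set R.
      apply/seteqP; split=> u /=; rewrite !in_itv /=.
        by move=> /andP[u0 u1]; case: (leP u 2^-1) => h; [left|right];
          apply/andP; split=> //; exact: ltW.
      by move=> [] /andP[? ?]; apply/andP; split=> //; lra.
    apply: withinU_continuous; [exact: interval_closed|exact: interval_closed| |].
      apply: (@subspace_eq_continuous _ _ _ (g1 \o p1)).
        move=> u; rewrite inE /= in_itv /= => /andP[_ uh].
        by rewrite /from_subspace /gam uh.
      apply: within_path_comp => // u /=; rewrite in_itv /= => /andP[? ?].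
      exact: p1I.
    apply: (@subspace_eq_continuous _ _ _ (g2 \o p2)).
      move=> u; rewrite inE /= in_itv /= => /andP[uh _].
      by rewrite /from_subspace gam2.
    apply: within_path_comp => // u /=; rewrite in_itv /= => /andP[? ?].
    exact: p2I.
  - by rewrite /gam ifT ?invr_ge0 // /p1 mulr0.
  - rewrite gam2; first by rewrite /p2 (_ : 2 * 1 - 1 = 1) //; lra.
    by lra.
  - move=> u; rewrite in_itv /= => /andP[u0 u1].
    have [h|h] := leP u 2^-1; first by rewrite /gam h; apply/g1U/p1I.
    by rewrite gam2 1?ltW //; apply/g2U/p2I => //; exact: ltW.
move=> i; rewrite permM.
have [F1 [aF1 cF1 F10 F11]] := y1 i.
have [F2 [aF2 cF2 F20 F21]] := y2 (s1 i).
pose F u := if u <= 2^-1 then F1 (p1 u) else F2 (p2 u).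
have glue : germ_eq x0 (F2 0) (F1 1).
  rewrite g20 in F20; rewrite g11 in F11.
  by move: F20 F11; apply: filterS2 => x -> ->.
exists F; split.
- move=> u; rewrite in_itv /= => /andP[u0 u1]; rewrite /gam /F.
  case: leP => h; first by apply/aF1/p1I.
  by apply/aF2/p2I => //; exact: ltW.
- move=> t; rewrite in_itv /= => /andP[t0 t1].
  have [h|h|h] := ltgtP t 2^-1.
  + have := continues_to_comp cp1 cF1 (p1I t t0 (ltW h)).
    move: (lt_nbhsl h); apply: (@filterS2 _ (nbhs t)) => s sh; rewrite in_itv /= => cs /andP[s0 s1'].
    have := cs (p1I s s0 (ltW sh)).
    by rewrite /F /gam (ltW sh) (ltW h).
  + have := continues_to_comp cp2 cF2 (p2I t (ltW h) t1).
    move: (lt_nbhsr h); apply: (@filterS2 _ (nbhs t)) => s sh; rewrite in_itv /= => cs /andP[s0 s1'].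
    have := cs (p2I s (ltW sh) s1').
    by rewrite /F /gam !leNgt sh h.
  + have It1 : p1 t \in `[0, 1] by apply: p1I; rewrite // h.
    have It2 : p2 t \in `[0, 1] by apply: p2I; rewrite // h.
    have n1 := continues_to_comp cp1 cF1 It1.
    have n2 := continues_to_comp cp2 cF2 It2.
    have n3 : \forall s \near t, p2 s \in `[0, 1] ->
        germ_eq (g2 (p2 s)) (F2 0) (F1 1).
      have I0 : [set` `[0, 1]] (0 : R) by rewrite /= in_itv /= lexx ler01.
      have /subspace_continuousP/(_ 0 I0) g2c := cg2.
      have nx : nbhs (g2 0) (fun x => germ_eq x (F2 0) (F1 1)).
        by rewrite g20; exact: (nbhs_interior glue).
      have := g2c _ nx; rewrite /= nbhs_simpl /= => n3.
      have p2t : nbhs (p2 t) = nbhs (0 : R) by rewrite h p2h.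
      by have := cp2 t; rewrite /continuous_at p2t => /(_ _ n3).
    move: n1 n2 n3; apply: (@filterS3 _ (nbhs t)) => s n1 n2 n3.
    rewrite in_itv /= => /andP[s0 s1'].
    rewrite /F /gam h lexx p1h.
    have [sh|sh] := leP s 2^-1.
      by have := n1 (p1I s s0 sh); rewrite h p1h.
    have Is := p2I s (ltW sh) s1'.
    have := n2 Is; have := n3 Is; rewrite h p2h.
    by apply: filterS2 => x -> ->.
- by move: F10; rewrite /gam /F invr_ge0 ler0n /p1 mulr0.
- have h1 : (1 <= 2^-1 :> R) = false by rewrite leNgt invf_lt1 ?ltr1n ?ltr0n.
  have e : p2 1 = 1 by rewrite /p2; lra.
  by move: F21; rewrite /gam /F h1 e.
Qed.

(* A rational function has an analytic germ at a exactly when the denominator of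
   its reduced form does not vanish at a. *)
Definition rational_germ (a : V) (f : V -> C) : Prop :=
  exists p q : mpoly N C,
    q.@[a] != 0 /\ germ_eq a f (fun x => p.@[x] / q.@[x]).

(* The quotient h = f1 / f2 of germs is expressed by h * f2 = f1 with f2 not
   identically zero, since f2 may vanish at a although the quotient is
   analytic there. *)
Definition arithmetic_germ (a : V) (f1 f2 h : V -> C) : Prop :=
  [\/ germ_eq a h (fun x => f1 x + f2 x),
      germ_eq a h (fun x => f1 x - f2 x),
      germ_eq a h (fun x => f1 x * f2 x)
    | ~ germ_eq a f2 (fun=> 0) /\ germ_eq a (fun x => h x * f2 x) f1].

Definition radical_step (a : V) (k : nat) (g : 'I_k -> V -> C) (i : 'I_k) :
    Prop :=
  [\/ rational_germ a (g i),
      exists j l : 'I_k,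
        [/\ (j < i)%N, (l < i)%N & arithmetic_germ a (g j) (g l) (g i)]
    | exists (j : 'I_k) (q : nat),
        [/\ (j < i)%N, (0 < q)%N & germ_eq a (fun x => g i x ^+ q) (g j)]].

(* The last germ g ord_max is the germ of the algebraic function. *)
Definition representable_by_radicals (P : {poly mpoly N C}) : Prop :=
  exists (a : V) (k : nat) (g : 'I_k.+1 -> V -> C),
    [/\ forall i, analytic_at a (g i), forall i, radical_step a g i
      & germ_of P a (g ord_max)].

End Germs.

Arguments all_germs_of {R N} P a y.
Arguments monodromy_group {R N} P x0 y.
Arguments monodromy_groupP {R N P x0 y s}.
Arguments monodromy_group_set {R N P x0 y}.

(* Main.v *)
Require Import Defs.
From HB Require Import structures.
From mathcomp Require Import all_boot all_order all_algebra.
From mathcomp Require Import all_fingroup all_solvable complex.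
From mathcomp Require Import all_classical all_reals all_analysis.
From mathcomp Require Import -(notations) mpoly.
From mathcomp Require Import all_field finmap zify ring lra.

(** The monodromy group is a subgroup of the Galois group of the equation
    over the field K of rational functions, because analytic continuation
    preserves algebraic relations; and a root of the equation in a radical
    tower over K makes that Galois group solvable.

    Fields of germs. The polynomials in finitely many analytic germs at a
    point form an integral domain, whose field of fractions contains K
    (germ_field, germ_base). Let L0 be the field obtained from the germs y_i
    at x0, and L1 the one obtained at a from the germs g_j of a
    representation by radicals. A loop that continues each y_i to y_(s i)
    preserves relations along the way (germ_zero_continuation), so y_i |->
    y_(s i) extends to an automorphism of L0 over K
    (continuation_automorphism).

    The identity theorem. Both the absence of zero divisors and the
    permanence of relations rest on it. Here it is proved for the functions
    f that, near a point, are approximated at every exponential rate in d by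
    polynomials of degree O(d) (exp_approx). Convergent power series have
    this property, and it is stable under sums and products. If f vanishes
    on a polydisc, then its approximants are small there. On the polydisc of
    twice the radius a polynomial of degree D grows by a factor 2^(D+1) at
    most (poly_growth), which loses against a good rate of approximation;
    thus f vanishes there as well (exp_approx_identity).

    Galois theory. L0 and L1 are compared through K alone: a splitting field
    E over K contains copies r_i of the y_i and h_j of the g_j that satisfy
    the same relations over K. If two automorphisms of E fix h^q, they
    multiply h by roots of unity, which lie in K, so that their commutator
    fixes h. It follows by induction that the j-th derived subgroup of
    Gal(E/K) fixes h_j (der_fixes_tower). The last h_j is a root of the
    irreducible equation, and the derived subgroup is normal in a group that
    permutes the roots transitively, so it fixes all roots. Each monodromy
    permutation of the y_i is induced on the r_i by an element of Gal(E/K).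
    Therefore a derived subgroup of the monodromy group is trivial
    (solvable_of_radical_tower). *)

Set Implicit Arguments.
Unset Strict Implicit.
Unset Printing Implicit Defensive.
Import Order.TTheory GRing.Theory Num.Theory.
Import numFieldTopology.Exports numFieldNormedType.Exports.

Local Open Scope classical_set_scope.
Local Open Scope ring_scope.

(** * Fraction fields and quotients by prime ideals *)

Local Notation qrepr := generic_quotient.repr.

Lemma fractionE (D : idomainType) (x : {fraction D}) :
  exists n d : D, d != 0 /\ x * tofrac d = tofrac n.
Proof.
exists (qrepr x).1, (qrepr x).2; split; first exact: denom_ratioP.
rewrite -{1}[x]generic_quotient.reprK !piE.
apply/eqP; rewrite FracField.equivf_def /FracField.equivf /= /FracField.mulf.
rewrite !numden_Ratio ?mulf_neq0 ?denom_ratioP ?oner_neq0 //.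
by rewrite !mulr1 mulrC.
Qed.

(** The fraction n / d is sent to f n / f d; all the representations n / d of an
    element give the same value. *)
Lemma fraction_lift (D : idomainType) (L : fieldType) (f : {rmorphism D -> L}) :
  injective f ->
  exists F : {rmorphism {fraction D} -> L}, forall x, F (tofrac x) = f x.
Proof.
move=> injf.
have f0 x : (f x == 0) = (x == 0) by rewrite -(rmorph0 f) (inj_eq injf).
have fE (n d n' d' : D) (x : {fraction D}) : d != 0 -> d' != 0 ->
    x * tofrac d = tofrac n -> x * tofrac d' = tofrac n' ->
      f n / f d = f n' / f d'.
  move=> d0 d'0 xn xn'.
  apply/eqP; rewrite eqr_div ?f0 // -!rmorphM; apply/eqP; congr (f _).
  by apply/eqP; rewrite -tofrac_eq !tofracM -xn -xn' mulrAC.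
have [F0 F0E] : exists F0 : {fraction D} -> L, forall x n d, d != 0 ->
    x * tofrac d = tofrac n -> F0 x = f n / f d.
  have /choice[nd ndE] : forall x : {fraction D}, exists nd : D * D,
      nd.2 != 0 /\ x * tofrac nd.2 = tofrac nd.1.
    by move=> x; have [n [d ?]] := fractionE x; exists (n, d).
  exists (fun x => f (nd x).1 / f (nd x).2) => x n d d0 xn.
  by have [? ?] := ndE x; apply: (fE _ _ _ _ x).
have F0f x : F0 (tofrac x) = f x.
  by rewrite (F0E _ x 1) ?oner_neq0 ?tofrac1 ?mulr1 // rmorph1 divr1.
have addF : zmod_morphism F0.
  move=> x y; have [n [d [d0 xn]]] := fractionE x.
  have [n' [d' [d'0 yn]]] := fractionE y.
  rewrite (F0E _ _ _ d0 xn) (F0E _ _ _ d'0 yn).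
  rewrite (F0E (x - y) (n * d' - n' * d) (d * d')) ?mulf_neq0 //.
    rewrite -[in RHS]mulNr addf_div ?f0 //; congr (_ / _); last exact: rmorphM.
    by rewrite rmorphB !rmorphM mulNr.
  rewrite mulrBl tofracB !tofracM -xn -yn; congr (_ - _).
    exact: mulrA.
  by rewrite mulrCA mulrC.
have mulF : monoid_morphism F0.
  split; first by rewrite -tofrac1 F0f rmorph1.
  move=> x y; have [n [d [d0 xn]]] := fractionE x.
  have [n' [d' [d'0 yn]]] := fractionE y.
  rewrite (F0E _ _ _ d0 xn) (F0E _ _ _ d'0 yn).
  rewrite (F0E (x * y) (n * n') (d * d')) ?mulf_neq0 //.
    by rewrite !rmorphM mulf_div.
  by rewrite !tofracM -xn -yn mulrACA.
pose hA := GRing.isZmodMorphism.Build _ _ F0 addF.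
pose hM := GRing.isMonoidMorphism.Build _ _ F0 mulF.
pose F : {rmorphism {fraction D} -> L} := HB.pack F0 hA hM.
by exists F.
Qed.

Section PrimeQuotient.
Variables (S : comNzRingType) (J : prime_idealr S).

(** A name of its own lets the quotient carry a structure of integral domain, in
    which the inverses of the units are obtained by choice. *)
Definition prime_quotient := {ideal_quot J}.
HB.instance Definition _ := GRing.ComNzRing.on prime_quotient.

Definition pq_unit : {pred prime_quotient} :=
  fun x => `[< exists y, y * x = 1 >].
Definition pq_inv (x : prime_quotient) : prime_quotient :=
  if pq_unit x then xget x [set y | y * x = 1] else x.

Fact pq_mulVx : {in pq_unit, left_inverse 1 pq_inv *%R}.
Proof.
move=> x ux; rewrite /pq_inv (_ : pq_unit x = true) //.
by have /asboolP[y yx] := ux; case: xgetP => [z _ //|/(_ y)].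
Qed.

Fact pq_unitP (x y : prime_quotient) : y * x = 1 -> pq_unit x.
Proof. by move=> yx; apply/asboolP; exists y. Qed.

Fact pq_inv_out : {in [predC pq_unit], pq_inv =1 id}.
Proof.
move=> x; rewrite inE /pq_inv => ux; rewrite (_ : pq_unit x = false) //.
exact/negbTE.
Qed.

HB.instance Definition _ :=
  GRing.ComNzRing_hasMulInverse.Build prime_quotient pq_mulVx pq_unitP
    pq_inv_out.

Fact pq_idomain : GRing.integral_domain_axiom prime_quotient.
Proof. exact: Quotient.rquot_IdomainAxiom. Qed.

HB.instance Definition _ :=
  GRing.ComUnitRing_isIntegral.Build prime_quotient pq_idomain.
End PrimeQuotient.

(** The field is the field of fractions of S / I. Its universal property
    turns an automorphism of S that preserves I into an automorphism of the
    field. *)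
Lemma prime_ideal_kernel (S : comNzRingType) (I : S -> Prop) :
  I 0 -> ~ I 1 -> (forall u v, I u -> I v -> I (u - v)) ->
  (forall a u, I u -> I (a * u)) -> (forall u v, I (u * v) -> I u \/ I v) ->
  exists (L : fieldType) (phi : {rmorphism S -> L}),
    (forall u, phi u = 0 <-> I u) /\
    forall (L' : fieldType) (psi : {rmorphism S -> L'}),
      (forall u, psi u = 0 <-> I u) ->
      exists F : {rmorphism L -> L'}, forall u, F (phi u) = psi u.
Proof.
move=> I0 I1 IB IM IP.
pose J0 : {pred S} := fun u => `[< I u >].
have Jideal : idealr_closed J0.
  split; [exact/asboolP|exact/asboolPn|].
  move=> a u v /asboolP Iu /asboolP Iv; apply/asboolP.
  by rewrite -[v]opprK -[- v]sub0r; apply: (IB); [exact: (IM)|exact: (IB)].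
have Jprime : prime_idealr_closed J0.
  by move=> u v /asboolP /IP[] ?; apply/orP; [left|right]; apply/asboolP.
pose hJ := isIdealr.Build S J0 Jideal.
pose hJP := isPrimeIdealrClosed.Build S J0 Jprime.
pose J : prime_idealr S := HB.pack J0 hJ hJP.
pose Q := prime_quotient J.
pose p : {rmorphism S -> Q} := \pi_({ideal_quot J})%qT.
have pE u v : p u = p v <-> I (u - v).
  split; last by move=> Iuv; apply/eqP; rewrite eqmodE; apply/asboolP.
  by move/eqP; rewrite eqmodE => /asboolP.
exists {fraction Q}, (@tofrac Q \o p); split=> [u|L' psi kerpsi].
  rewrite /= -(subr0 u) -pE rmorph0 subr0; split=> [/eqP|->].
    by rewrite tofrac_eq0 => /eqP.
  by rewrite rmorph0.
pose f0 (x : Q) : L' := psi (qrepr x).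
have f0E u : f0 (p u) = psi u.
  apply/eqP; rewrite -subr_eq0 -rmorphB; apply/eqP/kerpsi; apply/pE.
  by rewrite /p /= generic_quotient.reprK.
have surj (x : Q) : exists u, x = p u.
  by exists (qrepr x); rewrite /p /= generic_quotient.reprK.
have addf : zmod_morphism f0.
  move=> x y; have [u ->] := surj x; have [v ->] := surj y.
  by rewrite -rmorphB !f0E rmorphB.
have mulf : monoid_morphism f0.
  split; first by rewrite -(rmorph1 p) f0E rmorph1.
  move=> x y; have [u ->] := surj x; have [v ->] := surj y.
  by rewrite -rmorphM !f0E rmorphM.
pose hA := GRing.isZmodMorphism.Build _ _ f0 addf.
pose hM := GRing.isMonoidMorphism.Build _ _ f0 mulf.
pose f : {rmorphism Q -> L'} := HB.pack f0 hA hM.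
have injf : injective f.
  move=> x y; have [u ->] := surj x; have [v ->] := surj y.
  rewrite [f (p u)]f0E [f (p v)]f0E => e; apply/pE/kerpsi.
  by rewrite rmorphB e subrr.
have [F FE] := fraction_lift injf.
by exists F => u; rewrite /= FE; apply: f0E.
Qed.

(** * Splitting fields and primitive elements *)

Lemma irreducible_factor (F : fieldType) (p : {poly F}) : (1 < size p)%N ->
  exists2 r, r %| p & irreducible_poly r.
Proof.
move=> p1.
pose Q n := `[< exists2 r : {poly F}, r %| p & (1 < size r)%N /\ size r = n >].
have exQ : exists n, Q n by exists (size p); apply/asboolP; exists p.
case: (ex_minnP exQ) => n /asboolP[r rp [r1 rn]] nmin.
exists r => //; split=> // q q1 qr; rewrite -dvdp_size_eqp // eqn_leq.
have r0 : r != 0 by rewrite -size_poly_gt0 ltnW.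
rewrite dvdp_leq //= rn nmin //; apply/asboolP; exists q.
  exact: dvdp_trans rp.
by split=> //; rewrite ltn_neqAle eq_sym q1 size_poly_gt0 (dvdpN0 qr).
Qed.

Lemma extension_with_root (F : fieldType) (p : {poly F}) : (1 < size p)%N ->
  exists (K : fieldExtType F) (x : K), root (map_poly (in_alg K) p) x.
Proof.
move=> /irreducible_factor[r /divpK <- irr].
have [K _ [x rx _]] := irredp_FAdjoin irr.
by exists K, x; rewrite rmorphM rootM rx orbT.
Qed.

(** One root is split off at a time: the cofactor is split over the extension
    that contains the root, and the result is regarded as an extension of F. *)
Lemma extension_splits (F : fieldType) (p : {poly F}) : p != 0 ->
  exists (L : fieldExtType F) (rs : seq L),
    map_poly (in_alg L) p %= \prod_(z <- rs) ('X - z%:P).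
Proof.
have [n] := ubnP (size p); elim: n => // n IHn in F p * => pn p0.
have [p1|p1] := leqP (size p) 1%N.
  exists F^o, [::]; rewrite big_nil -size_poly_eq1 size_map_poly eqn_leq p1.
  by rewrite size_poly_gt0.
have [K [x /factor_theorem[q pE]]] := extension_with_root p1.
have q0 : q != 0.
  by apply: contraNneq p0 => q0; rewrite -(map_poly_eq0 (in_alg K)) pE q0 mul0r.
have qn : (size q < n)%N.
  by move: pn; rewrite -(size_map_poly (in_alg K)) pE size_Mmonic ?monicXsubC //
    size_XsubC addn2.
have [L [rs qE]] := IHn K q qn q0.
exists (baseFieldType L), (in_alg L x :: rs).
have -> : map_poly (in_alg (baseFieldType L)) p =
          map_poly (in_alg L) (map_poly (in_alg K) p).
  rewrite -map_poly_comp; apply: eq_map_poly => c.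
  exact: baseField_scaleE.
by rewrite pE rmorphM /= map_polyXsubC big_cons mulrC eqp_mull.
Qed.

(** A field in which p splits need not be normal over F, but the subfield that
    the roots of p generate is. *)
Lemma splitting_field_exists (F : fieldType) (p : {poly F}) : p != 0 ->
  exists (E : splittingFieldType F) (rs : seq E),
    map_poly (in_alg E) p %= \prod_(z <- rs) ('X - z%:P).
Proof.
move=> /extension_splits[L [rs pE]].
pose U := <<1 & rs>>%AS; pose E : fieldExtType F := subvs_of U.
pose us : seq E := map (vsproj U) rs; pose inc := linfun (vsval : E -> L).
have usE : map inc us = rs.
  rewrite -map_comp map_id_in // => z /seqv_sub_adjoin zU.
  by rewrite /= lfunE /= vsprojK.
have splitE : map_poly (in_alg E) p %= \prod_(z <- us) ('X - z%:P).
  rewrite -(eqp_map inc) -map_poly_comp (eq_map_poly (g := in_alg L)).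
    rewrite rmorph_prod (eq_bigr (fun z => 'X - (inc z)%:P)) => [|z _].
      by rewrite -(big_map inc predT (fun z => 'X - z%:P)) usE.
    exact: map_polyXsubC.
  by move=> c /=; rewrite linearZ /= rmorph1.
have genE : <<1 & us>>%VS = fullv.
  apply/vspaceP => u; rewrite memvf.
  have : inc u \in (inc @: <<1 & us>>)%VS.
    by rewrite aimg_adjoin_seq aimg1 usE lfunE /= subvsP.
  by case/memv_imgP => v vU; rewrite !lfunE => /val_inj ->.
have axE : SplittingField.axiom E.
  exists (map_poly (in_alg E) p); last by exists us.
  by apply/polyOverP => i; rewrite coef_map memvZ ?mem1v.
pose hE := FieldExt_isSplittingField.Build F E axE.
pose E' : splittingFieldType F := HB.pack (E : Type) E hE.
by exists E', us.
Qed.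

(** For t algebraic over F this is membership in F(t), as then F(t) = F[t]. *)
Definition in_simple (F L : fieldType) (iota : {rmorphism F -> L}) (t w : L) :=
  exists q : {poly F}, (map_poly iota q).[t] = w.

Section Simple.
Variables (F L : fieldType) (iota : {rmorphism F -> L}).
Local Notation "q ^@" := (map_poly iota q) (at level 2, format "q ^@").

Lemma in_simple_comp t u w : in_simple iota t u -> in_simple iota u w ->
  in_simple iota t w.
Proof.
move=> [p <-] [q <-]; exists (q \Po p).
by rewrite map_comp_poly horner_comp.
Qed.

Lemma irreducible_annihilator t : algebraicOver iota t ->
  exists2 m : {poly F}, irreducible_poly m & root (m^@) t.
Proof.
move=> [p]; have [n] := ubnP (size p); elim: n p => // n IHn p pn p0 pt.
have p1 : (1 < size p)%N.
  rewrite ltnNge; apply/negP => /size1_polyC pC; move: pt p0.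
  by rewrite pC map_polyC rootC fmorph_eq0 polyC_eq0 => ->.
have [r rp irr] := irreducible_factor p1; have [r1 _] := irr.
move: pt; rewrite -(divpK rp) rmorphM rootM => /orP[qt|]; last by exists r.
have r0 : r != 0 by rewrite -size_poly_gt0 ltnW.
apply: (IHn (p %/ r)) qt.
  rewrite size_divp // -ltnS (leq_trans _ pn) // ltnS ltn_subrL.
  by rewrite -ltnS prednK ?(ltnW r1) // r1 ltnW.
by apply: contraNneq p0 => q0; rewrite -(divpK rp) q0 mul0r.
Qed.

(** The primitive element is an integral combination of the z i, so that an
    automorphism that permutes the z i sends it to the combination of the
    permuted z i with the same coefficients. *)
Lemma primitive_element (pcharF : [pchar F] =i pred0) n (z : 'I_n -> L) :
  (forall i, algebraicOver iota (z i)) ->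
  exists (t : L) (c : 'I_n -> int),
    [/\ algebraicOver iota t, t = \sum_i z i *~ c i
      & forall i, in_simple iota t (z i)].
Proof.
elim: n z => [|n IHn] z zalg.
  exists 0, (fun=> 0); split=> [||[]//]; first exact: algebraic0.
  by rewrite big_ord0.
have [i|t [c [[p p0 pt] tE tz]]] := IHn (fun i => z (lift ord0 i)).
  exact: zalg.
have [q q0 qz] := zalg ord0.
have [m /= [tu zu]] := pchar0_PET p0 pt q0 qz pcharF.
set u := z ord0 *+ m - t in tu zu.
exists u, (fun i => if unlift ord0 i is Some j then - c j else m%:Z); split.
- apply: algebraic_sub; last by exists p.
  have -> : z ord0 *+ m = iota m%:R * z ord0 by rewrite rmorph_nat mulr_natl.
  by apply: algebraic_mul (zalg _); apply: algebraic_id.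
- rewrite /u big_ord_recl unlift_none pmulrn; congr (_ + _).
  by rewrite tE -sumrN; apply: eq_bigr => i _; rewrite liftK mulrNz.
- move=> i; have [j ->|->] := unliftP ord0 i; last exact: zu.
  exact: in_simple_comp tu (tz j).
Qed.
End Simple.

(** * Radical towers and derived subgroups of Galois groups *)

(** The embedding i of the base is a parameter: the same notion is used in a
    field of germs and in a splitting field. *)
Definition radical_tower (K : Type) (F : fieldType) (i : K -> F) (k : nat)
    (g : 'I_k -> F) := forall a : 'I_k,
  [\/ exists c, g a = i c,
      exists j l : 'I_k, [/\ (j < a)%N, (l < a)%N &
        [\/ g a = g j + g l, g a = g j - g l, g a = g j * g l
          | g l != 0 /\ g a * g l = g j]]
    | exists (j : 'I_k) (q : nat), [/\ (j < a)%N, (0 < q)%N & g a ^+ q = g j]].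

Section Galois.
Variables (K : fieldType) (E : splittingFieldType K).
Local Notation Gam := 'Gal({:E} / 1%AS)%g.

Lemma gal_scalar (x : gal_of {:E}) c : x \in Gam -> x c%:A = c%:A.
Proof.
move=> xG; have s1 : (1%AS <= {:E}%AS)%VS := subvf _.
by rewrite (@fixed_gal K E 1%AS {:E}%AS x (c%:A) s1 xG) //= memvZ ?mem1v.
Qed.

Lemma der_antimono n m : (n <= m)%N -> (Gam^`(m) \subset Gam^`(n))%g.
Proof.
elim: m => [|m IHm]; first by rewrite leqn0 => /eqP->.
rewrite leq_eqVlt => /predU1P[-> //|/IHm]; apply: fintype.subset_trans.
exact: der_subS.
Qed.

Hypothesis rootsK : forall q, (0 < q)%N -> exists w : K, q.-primitive_root w.

Lemma unity_root_scalar (z : E) q : (0 < q)%N -> z ^+ q = 1 ->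
  exists c : K, z = c%:A.
Proof.
move=> q0 zq; have [w wq] := rootsK q0.
have wq' : q.-primitive_root (in_alg E w) by rewrite fmorph_primitive_root.
have [j ->] := prim_rootP wq' zq.
by exists (w ^+ j); rewrite -(rmorphXn (in_alg E)).
Qed.

(** (x h / h)^q = 1, and K contains the roots of unity. *)
Lemma gal_radical (h : E) q (x : gal_of {:E}) : (0 < q)%N -> h != 0 ->
  x (h ^+ q) = h ^+ q -> exists2 c : K, c != 0 & x h = c *: h.
Proof.
move=> q0 h0; rewrite rmorphXn => xhq.
have [|c xc] := @unity_root_scalar (x h / h) q q0.
  by rewrite expr_div_n xhq divff // expf_neq0.
have xhE : x h = c *: h by rewrite -mulr_algl -xc divfK.
exists c => //; apply: contra_neq h0 => c0.
by apply/eqP; rewrite -(fmorph_eq0 x); apply/eqP; move: xhE; rewrite c0 scale0r.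
Qed.

Lemma fixer_group (h : E) :
  group_set [set x : gal_of {:E} | (x \in Gam) && (x h == h)]%SET.
Proof.
apply/group_setP; split; first by rewrite inE group1 gal_id eqxx.
move=> x y /[!inE] /andP[xG /eqP xh] /andP[yG /eqP yh].
by rewrite groupM //= galM ?memvf // xh yh.
Qed.

(** Two automorphisms that fix h^q multiply h by scalars, so that their
    commutator fixes h. *)
Lemma der_fixes_radical n (h : E) q : (0 < q)%N ->
  (forall x, x \in (Gam^`(n))%g -> x (h ^+ q) = h ^+ q) ->
  forall x, x \in (Gam^`(n.+1))%g -> x h = h.
Proof.
move=> q0 fixq x; have [->|h0] := eqVneq h 0; first by rewrite rmorph0.
suff : (Gam^`(n.+1) \subset Group (fixer_group h))%g.
  by move=> /fintype.subsetP sub /sub; rewrite inE => /andP[_ /eqP].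
rewrite dergSn gen_subG; apply/fintype.subsetP => _ /imset2P[u v un vn ->].
have uG : u \in Gam by apply: fintype.subsetP un; apply: der_sub.
have vG : v \in Gam by apply: fintype.subsetP vn; apply: der_sub.
rewrite inE groupR //=.
have [c c0 uh] := gal_radical q0 h0 (fixq u un).
have [d d0 vh] := gal_radical q0 h0 (fixq v vn).
have cG : [~ u, v]%g \in Gam by rewrite groupR.
have uvh : (u * v)%g h = (c * d) *: h.
  by rewrite galM ?memvf // uh linearZ /= vh scalerA.
have vuh : (v * u)%g h = (c * d) *: h.
  by rewrite galM ?memvf // vh linearZ /= uh scalerA mulrC.
have : (v * u * [~ u, v])%g h = (c * d) *: h by rewrite -commgC.
rewrite galM ?memvf // vuh linearZ /=; move/(scalerI (mulf_neq0 c0 d0)) => ->.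
exact: eqxx.
Qed.

(** Sums, differences, products and quotients inherit invariance, and extracting
    a root costs one derived subgroup. The entry of index 0 is a scalar, so that
    the entry of index a is reached by at most a extractions of roots. *)
Lemma der_fixes_tower k (h : 'I_k -> E) : @radical_tower K E (in_alg E) k h ->
  forall (a : 'I_k) x, x \in (Gam^`(a))%g -> x (h a) = h a.
Proof.
move=> tower a; have [m am] := ubnP (nat_of_ord a).
elim: m => // m IHm in a am *.
have IH (j : 'I_k) : (j < a)%N -> forall x, x \in (Gam^`(a))%g -> x (h j) = h j.
  move=> ja x xa; apply: IHm; first by lia.
  by apply: fintype.subsetP xa; apply: der_antimono; apply: ltnW.
have [[c ->]|[j [l [ja la hE]]]|[j [q [ja q0 hE]]]] := tower a => x xa.
- by apply: gal_scalar; apply: fintype.subsetP xa; apply: der_sub.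
- have [xj xl] := (IH j ja x xa, IH l la x xa).
  case: hE => [->|->|->|[l0 hE]].
  + by rewrite rmorphD /= xj xl.
  + by rewrite rmorphB /= xj xl.
  + by rewrite rmorphM /= xj xl.
  by apply: (mulIf l0); rewrite -{1}xl -rmorphM /= hE xj.
- apply: (@der_fixes_radical j _ q) => // [y yj|].
    by rewrite hE; apply: IHm; first by lia.
  by apply: fintype.subsetP xa; apply: der_antimono.
Qed.

(** Commutators of permutations that automorphisms realise are realised by the
    commutators of these automorphisms. *)
Lemma der_perm n (r : 'I_n -> E) (M : {group 'S_n}) j :
  (forall s, s \in M -> exists2 x, x \in Gam & forall i, x (r i) = r (s i)) ->
  forall s, s \in (M^`(j))%g ->
    exists2 x, x \in (Gam^`(j))%g & forall i, x (r i) = r (s i).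
Proof.
move=> MG; elim: j => [//|j IHj].
pose H := [set s : 'S_n |
  [exists x in (Gam^`(j.+1))%g, [forall i, x (r i) == r (s i)]]]%SET.
have HP (s : 'S_n) : reflect
    (exists2 x, x \in (Gam^`(j.+1))%g & forall i, x (r i) = r (s i)) (s \in H).
  rewrite inE; apply: (iffP exists_inP) => -[x xG xr]; exists x => //.
    by move=> i; apply/eqP/(forallP xr).
  by apply/forallP => i; apply/eqP.
have gH : group_set H.
  apply/group_setP; split.
    by apply/HP; exists 1%g => // i; rewrite gal_id perm1.
  move=> s t /HP[x xG xr] /HP[y yG yr]; apply/HP; exists (x * y)%g.
    exact: groupM.
  by move=> i; rewrite galM ?memvf // xr yr permM.
move=> s; suff : (M^`(j.+1) \subset Group gH)%g.
  by move=> /fintype.subsetP sub /sub /HP.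
rewrite dergSn gen_subG; apply/fintype.subsetP.
move=> _ /imset2P[u v /IHj[x xG xu] /IHj[y yG yv] ->].
apply/HP; exists [~ x, y]%g; first by apply: mem_commg.
have inv (z : gal_of {:E}) (w : 'S_n) : (forall i, z (r i) = r (w i)) ->
   forall i, (z^-1)%g (r i) = r ((w^-1)%g i).
  move=> zw i; rewrite -{1}(permKV w i) -zw -galM ?memvf // mulgV.
  by rewrite gal_id.
move=> i; rewrite !commgEl /conjg !galM ?memvf //.
by rewrite (inv x u xu) (inv y v yv) xu yv !permM.
Qed.

End Galois.

Lemma irreducible_root_dvdp (F L : fieldType) (iota : {rmorphism F -> L})
    (m : {poly F}) (t : L) : irreducible_poly m -> root (map_poly iota m) t ->
  forall q, root (map_poly iota q) t <-> m %| q.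
Proof.
move=> [m1 irrm] mt q; split; last first.
  by move=> /divpK <-; rewrite rmorphM rootM mt orbT.
move=> qt; have [g1|g1] := eqVneq (size (gcdp m q)) 1%N.
  have : coprimep (map_poly iota m) (map_poly iota q).
    by rewrite coprimep_map /coprimep g1.
  by move=> /coprimep_root/(_ mt); rewrite -/(root _ _) qt.
have := irrm _ g1 (dvdp_gcdl m q).
by move=> /eqp_dvdl <-; apply: dvdp_gcdr.
Qed.

Section SimpleTransfer.
Variables (F L L' : fieldType).
Variables (i : {rmorphism F -> L}) (i' : {rmorphism F -> L'}).
Variables (m : {poly F}) (t : L) (t' : L').
Hypotheses (irrm : irreducible_poly m).
Hypotheses (mt : root (map_poly i m) t) (mt' : root (map_poly i' m) t').

Lemma transfer_root p : root (map_poly i p) t <-> root (map_poly i' p) t'.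
Proof.
by rewrite (irreducible_root_dvdp irrm mt) (irreducible_root_dvdp irrm mt').
Qed.

(** The relations over F that hold at a root of an irreducible m are the
    multiples of m, in every extension of F: thus F[t] and F[t'] are copies
    of each other. *)
Lemma transfer_eq p q : (map_poly i p).[t] = (map_poly i q).[t] <->
  (map_poly i' p).[t'] = (map_poly i' q).[t'].
Proof.
have aux (M : fieldType) (j : {rmorphism F -> M}) (u : M) :
    (map_poly j p).[u] = (map_poly j q).[u] <-> root (map_poly j (p - q)) u.
  by rewrite /root rmorphB hornerD hornerN subr_eq0; split=> /eqP.
by rewrite !aux transfer_root.
Qed.
End SimpleTransfer.

Lemma dvdp_splits_root (F : fieldType) (m : {poly F}) rs :
  (1 < size m)%N -> m %| \prod_(z <- rs) ('X - z%:P) -> exists t, root m t.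
Proof.
move=> m1 /dvdp_prod_XsubC[b]; case: (mask b rs) => [|t s] e.
  by move: m1; rewrite (eqp_size e) big_nil size_poly1.
by exists t; rewrite (eqp_root e) big_cons rootM root_XsubC eqxx.
Qed.

Lemma gal_transitive (K : fieldType) (E : splittingFieldType K) (m : {poly K})
    (t t' : E) : irreducible_poly m ->
  root (map_poly (in_alg E) m) t -> root (map_poly (in_alg E) m) t' ->
  exists2 x, x \in 'Gal({:E} / 1%AS)%g & x t = t'.
Proof.
move=> irrm mt mt'.
have [mu muE] := polyOver1P (minPolyOver 1%AS t).
apply: normalField_root_minPoly; rewrite ?subvf ?normalFieldf ?memvf //.
rewrite muE; apply/(irreducible_root_dvdp irrm mt').
by apply/(irreducible_root_dvdp irrm mt); rewrite -muE root_minPoly.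
Qed.

Lemma horner_map_fixed (K L M : fieldType) (i : {rmorphism K -> L})
    (j : {rmorphism K -> M}) (s : {rmorphism L -> M}) (p : {poly K}) (t : L) :
  (forall c, s (i c) = j c) -> s (map_poly i p).[t] = (map_poly j p).[s t].
Proof.
by move=> sij; rewrite -horner_map -map_poly_comp (eq_map_poly (g := j)).
Qed.

(** The fields L0 and L1 have only K in common. Let t0 and t1 be primitive
    elements of K(y) and K(g). A splitting field E of the product of their
    minimal polynomials contains copies r and h of y and g, which satisfy
    the same relations over K. The k-th derived subgroup of the Galois group
    of E fixes the last entry of h, a root of P; being normal, it fixes all
    the conjugates of this root, among which are the r i. The permutations
    of the r i by G come from the Galois group, so the k-th derived subgroup
    of G is trivial. *)
Theorem solvable_of_radical_tower (K : fieldType) (P : {poly K})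
    (L0 : fieldType) (i0 : {rmorphism K -> L0}) n (y : 'I_n -> L0)
    (G : {group 'S_n})
    (L1 : fieldType) (i1 : {rmorphism K -> L1}) k (g : 'I_k.+1 -> L1) :
  [pchar K] =i pred0 ->
  (forall q, (0 < q)%N -> exists w : K, q.-primitive_root w) ->
  irreducible_poly P ->
  injective y -> (forall i, root (map_poly i0 P) (y i)) ->
  (forall s, s \in G -> exists f : {rmorphism L0 -> L0},
     (forall c, f (i0 c) = i0 c) /\ (forall i, f (y i) = y (s i))) ->
  radical_tower i1 g -> root (map_poly i1 P) (g ord_max) ->
  solvable G.
Proof.
move=> pcharK rootsK irrP yinj yP Gaut tower gP.
have P0 : P != 0 by have [P1 _] := irrP; rewrite -size_poly_gt0 ltnW.
have yalg i : algebraicOver i0 (y i) by exists P.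
have galg a : algebraicOver i1 (g a).
  have [m am] := ubnP (nat_of_ord a); elim: m => // m IHm in a am *.
  have IH (j : 'I_k.+1) : (j < a)%N -> algebraicOver i1 (g j).
    by move=> ja; apply: IHm; lia.
  have [[c ->]|[j [l [/IH aj /IH al]]]|[j [q [/IH [p p0 pj] q0 gE]]]] :=
    tower a.
  - exact: algebraic_id.
  - move=> [->|->|->|[l0 gE]]; first exact: algebraic_add.
    + exact: algebraic_sub.
    + exact: algebraic_mul.
    by rewrite -[g a](mulfK l0) gE; apply: algebraic_div.
  exists (p \Po 'X^q).
    by rewrite comp_poly_eq0 // size_polyXn; lia.
  by rewrite /root map_comp_poly horner_comp map_polyXn hornerXn gE.
have [t0 [c [t0alg t0E /choice[q qE]]]] := primitive_element pcharK yalg.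
have [t1 [_ [t1alg _ /choice[p pE]]]] := primitive_element pcharK galg.
have [m0 irr0 r0] := irreducible_annihilator t0alg.
have [m1 irr1 r1] := irreducible_annihilator t1alg.
have [irr0s _] := irr0; have [irr1s _] := irr1.
have m01 : m0 * m1 != 0 by rewrite mulf_neq0 // -size_poly_gt0 ltnW.
have [E [rs rsE]] := splitting_field_exists m01.
pose e := in_alg E.
have [T0 R0] : exists T, root (map_poly e m0) T.
  apply: (@dvdp_splits_root _ _ rs); first by rewrite size_map_poly.
  by rewrite -(eqp_dvdr _ rsE) rmorphM dvdp_mulr.
have [T1 R1] : exists T, root (map_poly e m1) T.
  apply: (@dvdp_splits_root _ _ rs); first by rewrite size_map_poly.
  by rewrite -(eqp_dvdr _ rsE) rmorphM dvdp_mull.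
have tr0 := transfer_eq irr0 r0 R0; have z0 := transfer_root irr0 r0 R0.
have tr1 := transfer_eq irr1 r1 R1; have z1 := transfer_root irr1 r1 R1.
pose r i := (map_poly e (q i)).[T0].
pose h a := (map_poly e (p a)).[T1].
have rinj : injective r by move=> i j /tr0; rewrite !qE => /yinj.
have rP i : root (map_poly e P) (r i).
  rewrite /root -horner_comp -map_comp_poly; apply/z0.
  by rewrite /root map_comp_poly horner_comp qE; exact: yP.
have hP : root (map_poly e P) (h ord_max).
  rewrite /root -horner_comp -map_comp_poly; apply/z1.
  by rewrite /root map_comp_poly horner_comp pE.
have htower : radical_tower e h.
  move=> a; have [[d gE]|[j [l [ja la gE]]]|[j [b [ja b0 gE]]]] := tower a.
  - apply: Or31; exists d; rewrite -[e d](hornerC _ T1) -(map_polyC e).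
    by apply/tr1; rewrite pE map_polyC hornerC.
  - apply: Or32; exists j, l; split=> //; case: gE => [gE|gE|gE|[l0 gE]].
    + apply: Or41; rewrite -hornerD -rmorphD; apply/tr1.
      by rewrite rmorphD hornerD !pE.
    + apply: Or42; rewrite -hornerN -hornerD -rmorphB; apply/tr1.
      by rewrite rmorphB hornerD hornerN !pE.
    + apply: Or43; rewrite -hornerM -rmorphM; apply/tr1.
      by rewrite rmorphM hornerM !pE.
    apply: Or44; split; last first.
      rewrite -hornerM -rmorphM; apply/tr1.
      by rewrite rmorphM hornerM !pE.
    by apply: contra_neq l0 => /eqP/z1/eqP; rewrite pE.
  apply: Or33; exists j, b; split=> //.
  rewrite -horner_exp -rmorphXn; apply/tr1.
  by rewrite rmorphXn horner_exp !pE.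
have Gr s : s \in G ->
    exists2 x, x \in 'Gal({:E} / 1%AS)%g & forall i, x (r i) = r (s i).
  move=> /Gaut[f [fi0 fy]].
  (* f t0 is a root of m0 in K[t0], namely the value of tau at t0. So tau sends
     T0 to another root of m0 in E, and an element of the Galois group does the
     same. *)
  pose tau := \sum_i q (s i) *~ c i.
  have tauE : (map_poly i0 tau).[t0] = f t0.
    pose at_t0 : {rmorphism {poly K} -> L0} := horner_eval t0 \o map_poly i0.
    rewrite -[LHS]/(at_t0 tau) t0E !rmorph_sum; apply: eq_bigr => i _.
    by rewrite !rmorphMz fy -qE.
  have ftau b : (map_poly i0 (b \Po tau)).[t0] = f (map_poly i0 b).[t0].
    rewrite map_comp_poly horner_comp tauE.
    by symmetry; apply: horner_map_fixed.
  have Etau b : (map_poly e (b \Po tau)).[T0] =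
      (map_poly e b).[(map_poly e tau).[T0]].
    by rewrite map_comp_poly horner_comp.
  have [|x xG xT] := @gal_transitive K E m0 T0 (map_poly e tau).[T0] irr0 R0.
    by rewrite /root -Etau; apply/z0; rewrite /root ftau (eqP r0) rmorph0.
  exists x => // i; rewrite /r (@horner_map_fixed K E E e e) => [|d].
    by rewrite /= xT -Etau; apply/tr0; rewrite ftau !qE fy.
  exact: gal_scalar.
have hfix x : x \in ('Gal({:E} / 1%AS)^`(k))%g -> x (h ord_max) = h ord_max.
  by move=> xk; apply: (der_fixes_tower rootsK htower (a := ord_max)).
have rfix x : x \in ('Gal({:E} / 1%AS)^`(k))%g -> forall i, x (r i) = r i.
  move=> xk i; have [z zG zh] := gal_transitive irrP hP (rP i).
  have zk : (z * x * z^-1 \in 'Gal({:E} / 1%AS)^`(k))%g.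
    rewrite -mulgA -{1}(invgK z) -conjgE memJ_norm // groupV.
    by apply: fintype.subsetP zG; apply: der_norm.
  rewrite -zh -galM ?memvf // -(mulgKV z (z * x)%g) galM ?memvf //.
  by rewrite (hfix _ zk).
apply/derivedP; exists k; apply/trivgP/fintype.subsetP => s sk.
have [x xk xr] := der_perm Gr sk.
rewrite inE; apply/eqP/permP => i; rewrite perm1; apply: rinj.
by rewrite -xr rfix.
Qed.

(** * Growth of polynomials on discs *)

Section Modulus.
Variable R : realType.
Local Notation C := R[i].
Local Notation nc := (@Normc.normc R).
Implicit Types z w : C.

Lemma ncE z : `|z| = real_complex R (nc z).
Proof. by []. Qed.

Lemma nc_ge0 z : 0 <= nc z.
Proof. by rewrite -lecR -ncE normr_ge0. Qed.

Lemma ncD z w : nc (z + w) <= nc z + nc w.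
Proof. by rewrite -lecR rmorphD /= -!ncE ler_normD. Qed.

Lemma ncN z : nc (- z) = nc z.
Proof. by apply: (@complexI R); rewrite -!ncE normrN. Qed.

Lemma ncB z w : nc (z - w) <= nc z + nc w.
Proof. by rewrite -(ncN w) ncD. Qed.

Lemma ncC z w : nc (z - w) = nc (w - z).
Proof. by rewrite -ncN opprB. Qed.

Lemma ncX z n : nc (z ^+ n) = nc z ^+ n.
Proof.
elim: n => [|n IHn]; first by rewrite !expr0 Normc.normc1.
by rewrite !exprS Normc.normcM IHn.
Qed.

Lemma nc_real (x : R) : 0 <= x -> nc (real_complex R x) = x.
Proof. by move=> x0; rewrite /= expr0n /= addr0 sqrtr_sqr ger0_norm. Qed.

Lemma nc_nat n : nc n%:R = n%:R.
Proof. by rewrite -(nc_real (ler0n _ n)) rmorph_nat. Qed.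

Lemma nc_sum (I : Type) (s : seq I) (F : I -> C) :
  nc (\sum_(i <- s) F i) <= \sum_(i <- s) nc (F i).
Proof.
elim: s => [|i s IHs]; first by rewrite !big_nil Normc.normc0.
by rewrite !big_cons (le_trans (ncD _ _)) // lerD2l.
Qed.

Lemma nc_eq0 z : (forall e : R, 0 < e -> nc z <= e) -> z = 0.
Proof.
move=> ze; apply: (@Normc.eq0_normc R); apply/eqP; rewrite eq_le nc_ge0 andbT.
by apply/ler_addgt0Pr => e e0; rewrite add0r ze.
Qed.

Lemma prim_root_exists (n : nat) : (0 < n)%N ->
  exists w : C, n.-primitive_root w.
Proof.
move=> n0; have [rs] := closed_field_poly_normal ('X^n - 1 : {poly C}).
rewrite lead_coefXnsubC // scale1r => rsE.
suff /hasP[w _ wn] : has n.-primitive_root rs by exists w.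
apply: has_prim_root => //.
- by apply/allP => z; rewrite -root_prod_XsubC -rsE.
- by rewrite -separable_prod_XsubC -rsE separable_Xn_sub_1 // pnatr_eq0 -lt0n.
by rewrite -ltnS -(size_prod_XsubC rs id) -rsE size_XnsubC.
Qed.

Lemma sum_unity_root n (z : C) : z ^+ n = 1 -> z != 1 ->
  \sum_(j < n) z ^+ j = 0.
Proof.
move=> zn z1; have /esym/eqP := subrX1 z n.
by rewrite zn subrr mulf_eq0 subr_eq0 (negbTE z1) => /eqP.
Qed.

(** Discrete Fourier inversion: the factor w^(j(n - k)) is w^(-jk), and the sum
    over j of w^(j(l - k)) is 0 unless l = k. *)
Lemma coef_unity_average n (w : C) (q : {poly C}) (h : C) (k : nat) :
  n.-primitive_root w -> (size q <= n)%N -> (k < n)%N ->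
  n%:R * (q`_k * h ^+ k) = \sum_(j < n) w ^+ (j * (n - k)) * q.[h * w ^+ j].
Proof.
move=> wn sq kn.
have E (j : 'I_n) : w ^+ (j * (n - k)) * q.[h * w ^+ j] =
    \sum_(l < n) q`_l * h ^+ l * (w ^+ (n - k + l)) ^+ j.
  rewrite (horner_coef_wide _ sq) mulr_sumr; apply: eq_bigr => l _.
  rewrite exprMn -!exprM mulnDl exprD -!mulrA.
  rewrite [(j * _)%N]mulnC [(l * j)%N]mulnC.
  by rewrite mulrCA; congr (_ * _); rewrite mulrCA.
rewrite (eq_bigr _ (fun j _ => E j)) exchange_big /= (bigD1 (Ordinal kn)) //=.
rewrite subnK ?(ltnW kn) // (prim_expr_order wn) [X in _ + X]big1 => [|l lk].
  rewrite addr0 (eq_bigr (fun=> q`_k * h ^+ k)) => [|j _]; last first.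
    by rewrite expr1n mulr1.
  by rewrite sumr_const card_ord mulr_natl.
rewrite -mulr_sumr sum_unity_root ?mulr0 //.
  by rewrite exprAC (prim_expr_order wn) expr1n.
rewrite -(expr0 w) (eq_prim_root_expr wn) mod0n.
apply: contra lk => /dvdnP[c cE]; apply/eqP/val_inj => /=.
have ln := ltn_ord l; move: cE; case: c => [|[|c]] /=; nia.
Qed.

(** Averaging over the roots of unity of order n bounds the k-th coefficient by
    M 2^k, as in the Cauchy estimates. *)
Lemma poly_growth (n : nat) (q : {poly C}) (M : R) : (size q <= n)%N ->
  (forall t, nc t <= 2^-1 -> nc q.[t] <= M) -> nc q.[1] <= M * 2 ^+ n.
Proof.
move=> sq qM; have M0 : 0 <= M.
  by apply: le_trans (qM 0 _); rewrite ?nc_ge0 // Normc.normc0 invr_ge0.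
have [n0|n0] := posnP n.
  have -> : q = 0 by apply/eqP; rewrite -size_poly_eq0 -leqn0 -n0.
  by rewrite horner0 Normc.normc0 mulr_ge0 // exprn_ge0.
have [w wn] := prim_root_exists n0.
have w1 : nc w = 1.
  apply/eqP; rewrite -(@pexpr_eq1 _ _ n) ?nc_ge0 // -ncX (prim_expr_order wn).
  by rewrite Normc.normc1.
have h2 : nc 2^-1 = 2^-1 by rewrite Normc.normcV nc_nat.
have coefM k : (k < n)%N -> nc q`_k <= M * 2 ^+ k.
  move=> kn; have := coef_unity_average 2^-1 wn sq kn.
  move=> /(congr1 nc); rewrite !Normc.normcM nc_nat ncX h2 => E.
  have : n%:R * (nc q`_k * 2^-1 ^+ k) <= n%:R * M.
    rewrite E (le_trans (nc_sum _ _)) //.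
    rewrite -[n in leRHS]card_ord -sum1_card natr_sum mulr_suml.
    apply: ler_sum => j _; rewrite Normc.normcM ncX w1 expr1n mul1r mul1r.
    by apply: qM; rewrite Normc.normcM h2 ncX w1 expr1n mulr1.
  rewrite ler_pM2l ?ltr0n // exprVn -ler_pdivlMr ?exprn_gt0 ?invr_gt0 //.
  by rewrite invrK.
rewrite (horner_coef_wide _ sq) (le_trans (nc_sum _ _)) //.
apply: (@le_trans _ _ (\sum_(k < n) M * 2 ^+ k)).
  by apply: ler_sum => k _; rewrite expr1n mulr1 coefM.
rewrite -mulr_sumr ler_wpM2l //.
have := subrX1 (2 : R) n; rewrite (_ : 2 - 1 = 1 :> R) ?mul1r => [<-|];
  last by lra.
by rewrite gerBl.
Qed.

End Modulus.

(** * Approximation by polynomials at exponential rates *)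

Section Approx.
Variables (R : realType) (N : nat).
Local Notation C := R[i].
Local Notation V := 'rV[C]_N.
Local Notation nc := (@Normc.normc R).
Implicit Types (a b x z v : V) (f g p : V -> C).

Definition polydisc b (r : R) : set V :=
  fun x => forall i, nc (x 0 i - b 0 i) < r.

Lemma nbhs_polydisc b (A : set V) :
  nbhs b A <-> exists2 r : R, 0 < r & polydisc b r `<=` A.
Proof.
split.
  move=> /nbhs_ballP[e /= e0 eA]; move: e0.
  rewrite ltcE /= => /andP[/eqP e1 e0]; exists (complex.Re e) => // x xb.
  apply: eA; split=> [|i j]; first by rewrite ltcE e1 eqxx.
  rewrite (ord1 i) /ball /= distrC ncE ltcE /= e1 eqxx /=; exact: xb.
move=> [r r0 rA]; apply/nbhs_ballP; exists (real_complex R r) => /=.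
  by rewrite ltcR.
move=> x [_ xb]; apply: rA => i; have := xb 0 i.
by rewrite /ball /= distrC ncE ltcR.
Qed.

Lemma polydisc_center b r : 0 < r -> polydisc b r b.
Proof. by move=> r0 i; rewrite subrr Normc.normc0. Qed.

Lemma polydiscW b r s : r <= s -> polydisc b r `<=` polydisc b s.
Proof. by move=> rs x xb i; apply: lt_le_trans rs. Qed.

Lemma polydisc_triangle b x r s : polydisc b r x ->
  polydisc x s `<=` polydisc b (r + s).
Proof.
move=> bx y xy i; rewrite (_ : _ - _ = (x 0 i - b 0 i) + (y 0 i - x 0 i)).
  by rewrite (le_lt_trans (ncD _ _)) // ltrD.
by ring.
Qed.

Lemma polydisc_sym b x r : polydisc b r x -> polydisc x r b.
Proof. by move=> bx i; rewrite ncC. Qed.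

Lemma polydisc_open b x r : polydisc b r x ->
  exists2 s : R, 0 < s & polydisc x s `<=` polydisc b r.
Proof.
move=> bx; have H i : nbhs x (fun y : V => nc (y 0 i - b 0 i) < r).
  apply/nbhs_polydisc; exists (r - nc (x 0 i - b 0 i)).
    by rewrite subr_gt0.
  move=> y /(_ i); rewrite ltrBrDr => yi; apply: le_lt_trans yi.
  by rewrite (le_trans _ (ncD _ _)) // (_ : _ + _ = y 0 i - b 0 i) //; ring.
have Hn := @filter_forall V _ (fun i y => nc (y 0 i - b 0 i) < r) (nbhs x)
  (nbhs_filter x) H.
by apply/nbhs_polydisc; apply: filterS Hn.
Qed.

(** The radii are real numbers, while those of the balls of V belong to C. *)
Definition continuous_point p x := forall e : R, 0 < e ->
  exists2 d : R, 0 < d & forall y, polydisc x d y -> nc (p y - p x) < e.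

Lemma continuous_pointD p q x : continuous_point p x -> continuous_point q x ->
  continuous_point (fun y => p y + q y) x.
Proof.
move=> cp cq e e0; have e2 : 0 < e / 2 by rewrite divr_gt0.
have [d d0 pd] := cp _ e2; have [d' d'0 qd] := cq _ e2.
exists (Num.min d d'); first by rewrite lt_min d0 d'0.
move=> y yx; rewrite (_ : _ - _ = (p y - p x) + (q y - q x)); last by ring.
rewrite (le_lt_trans (ncD _ _)) // [e]splitr ltrD //; [apply: pd|apply: qd];
  by apply: polydiscW yx; rewrite ge_min lexx ?orbT.
Qed.

Lemma continuous_pointM p q x : continuous_point p x -> continuous_point q x ->
  continuous_point (fun y => p y * q y) x.
Proof.
move=> cp cq e e0.
pose M := 1 + nc (p x) + nc (q x).
have M0 : 0 < M by rewrite ltr_wpDr ?nc_ge0 // ltr_wpDr ?nc_ge0.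
pose e' := Num.min 1 (e / (2 * M)).
have e'0 : 0 < e' by rewrite lt_min ltr01 divr_gt0 // mulr_gt0.
have [d d0 pd] := cp _ e'0; have [d' d'0 qd] := cq _ e'0.
exists (Num.min d d'); first by rewrite lt_min d0 d'0.
move=> y yx; rewrite (_ : _ - _ = (p y - p x) * q y + p x * (q y - q x));
  last by ring.
have {}pd : nc (p y - p x) < e'.
  by apply: pd; apply: polydiscW yx; rewrite ge_min lexx.
have {}qd : nc (q y - q x) < e'.
  by apply: qd; apply: polydiscW yx; rewrite ge_min lexx orbT.
have e'M : e' * M <= e / 2.
  rewrite -ler_pdivlMr // -mulrA -invfM; first by rewrite ge_min lexx orbT.
have qM : nc (q y) <= 1 + nc (q x).
  rewrite -[q y](subrK (q x)) (le_trans (ncD _ _)) // lerD2r ltW //.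
  by apply: lt_le_trans qd _; rewrite ge_min lexx.
apply: (@le_lt_trans _ _ (e' * M)); last by lra.
rewrite (le_trans (ncD _ _)) // !Normc.normcM.
have := nc_ge0 (p x); have := nc_ge0 (q y); have := nc_ge0 (p y - p x).
have := nc_ge0 (q y - q x); rewrite /M; nra.
Qed.

(** The estimates on polynomials in N variables are made one complex line at a
    time, so the degree is that of the restrictions to lines. *)
Definition line_poly (D : nat) p := (forall x, continuous_point p x) /\
  forall x v, exists2 q : {poly C}, (size q <= D.+1)%N &
    forall t, p (x + t *: v) = q.[t].

Lemma line_poly_cst c : line_poly 0 (fun=> c).
Proof.
split=> [x e e0|x v]; first by exists 1 => // y _; rewrite subrr Normc.normc0.
by exists c%:P => [|t]; rewrite ?size_polyC ?leq_b1 ?hornerC.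
Qed.

Lemma line_poly0_cst p : line_poly 0 p -> forall x z, p x = p z.
Proof.
move=> [_ pl] x z; have [q q1 pq] := pl x (z - x).
have := pq 0; have := pq 1; rewrite scale1r scale0r addr0 addrC subrK => -> ->.
by rewrite (size1_polyC q1) !hornerC.
Qed.

Lemma line_poly_coord i c : line_poly 1 (fun x => x 0 i - c).
Proof.
split=> [x e e0|x v].
  exists e => // y /(_ i).
  by rewrite (_ : _ - _ = y 0 i - c - (x 0 i - c)) //; ring.
exists ((v 0 i) *: 'X + (x 0 i - c)%:P) => [|t].
  rewrite (leq_trans (size_polyD _ _)) // geq_max.
  rewrite (leq_trans (size_scale_leq _ _)) ?size_polyX //.
  by rewrite size_polyC; case: eqP.
by rewrite !mxE hornerD hornerZ hornerX hornerC; ring.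
Qed.

Lemma line_polyW D D' p : (D <= D')%N -> line_poly D p -> line_poly D' p.
Proof.
move=> DD' [cp lp]; split=> // x v; have [q qD pq] := lp x v.
by exists q => //; apply: leq_trans qD _.
Qed.

Lemma line_polyD D p p' : line_poly D p -> line_poly D p' ->
  line_poly D (fun x => p x + p' x).
Proof.
move=> [cp lp] [cp' lp']; split=> [x|x v].
  by apply: continuous_pointD; [exact: cp|exact: cp'].
have [q qD pq] := lp x v; have [q' q'D pq'] := lp' x v.
exists (q + q') => [|t]; last by rewrite hornerD pq pq'.
by rewrite (leq_trans (size_polyD _ _)) // geq_max qD.
Qed.

Lemma line_polyM D D' p p' : line_poly D p -> line_poly D' p' ->
  line_poly (D + D') (fun x => p x * p' x).
Proof.
move=> [cp lp] [cp' lp']; split=> [x|x v].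
  by apply: continuous_pointM; [exact: cp|exact: cp'].
have [q qD pq] := lp x v; have [q' q'D pq'] := lp' x v.
exists (q * q') => [|t]; last by rewrite hornerM pq pq'.
by rewrite (leq_trans (size_polyMleq _ _)) //; lia.
Qed.

Lemma line_poly_sum (I : eqType) (s : seq I) D (p : I -> V -> C) :
  (forall i, i \in s -> line_poly D (p i)) ->
    line_poly D (fun x => \sum_(i <- s) p i x).
Proof.
elim: s => [|i s IHs] sp.
  under [X in line_poly _ X]eq_fun do rewrite big_nil.
  exact: line_polyW (line_poly_cst _).
under [X in line_poly _ X]eq_fun do rewrite big_cons.
apply: line_polyD; first by apply: sp; rewrite mem_head.
by apply: IHs => j js; apply: sp; rewrite inE js orbT.
Qed.

Lemma line_polyX D p n : line_poly D p -> line_poly (D * n) (fun x => p x ^+ n).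
Proof.
move=> Dp; elim: n => [|n IHn].
  by rewrite muln0; apply: line_poly_cst.
under [X in line_poly _ X]eq_fun do rewrite exprS.
by rewrite mulnS; apply: line_polyM.
Qed.

Lemma line_poly_prod (I : Type) (s : seq I) (D : I -> nat) (p : I -> V -> C) :
  (forall i, line_poly (D i) (p i)) ->
  line_poly (\sum_(i <- s) D i) (fun x => \prod_(i <- s) p i x).
Proof.
move=> Dp; elim: s => [|i s IHs].
  under [X in line_poly _ X]eq_fun do rewrite big_nil.
  by rewrite big_nil; apply: line_poly_cst.
under [X in line_poly _ X]eq_fun do rewrite big_cons.
by rewrite big_cons; apply: line_polyM.
Qed.

Definition rate (k d : nat) : R := 2^-1 ^+ (k * d).

Lemma rate_ge0 k d : 0 <= rate k d.
Proof. by rewrite exprn_ge0 // invr_ge0. Qed.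

Lemma rate_le1 k d : rate k d <= 1.
Proof. by rewrite exprn_ile1 ?invr_ge0 ?invf_le1 ?ler1n. Qed.

(** The degree of the approximants grows linearly in d, with a factor that
    does not depend on the rate k, whereas the radius does. For a convergent
    power series the Taylor polynomials serve, with Cd = 1; the freedom in
    Cd makes the notion stable under products. It replaces the re-expansion
    of power series: the identity theorem below only uses the competition
    between the degree Cd * d and the error 2^(-kd). *)
Definition exp_approx b f := exists Cd : nat, forall k : nat,
  exists (r B : R), 0 < r /\ forall d, exists p, line_poly (Cd * d) p /\
    forall x, polydisc b r x -> nc (f x - p x) <= B * rate k d.

Lemma exp_approx_cst b c : exp_approx b (fun=> c).
Proof.
exists 0%N => k; exists 1, 0; split=> // d; exists (fun=> c); split.
  exact: line_poly_cst.
by move=> x _; rewrite subrr Normc.normc0 mul0r.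
Qed.

Lemma exp_approx_coord b i : exp_approx b (fun x => x 0 i).
Proof.
exists 1%N => k; exists 1, 1; split=> // -[|d].
  exists (fun=> b 0 i); split; first exact: line_poly_cst.
  by move=> x /(_ i) xb; rewrite /rate muln0 expr0 mulr1 ltW.
exists (fun x => x 0 i - 0); split;
  first exact: (line_polyW _ (line_poly_coord _ _)).
by move=> x _; rewrite subr0 subrr Normc.normc0 mulr_ge0 ?rate_ge0.
Qed.

Lemma approx_bound_ge0 b f k r B (Cd : nat) : 0 < r ->
  (forall d, exists p, line_poly (Cd * d) p /\
    forall x, polydisc b r x -> nc (f x - p x) <= B * rate k d) -> 0 <= B.
Proof.
move=> r0 /(_ 0%N)[p [_ /(_ _ (polydisc_center b r0))]].
by rewrite /rate muln0 expr0 mulr1; apply: le_trans; apply: nc_ge0.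
Qed.

Lemma exp_approxD b f g : exp_approx b f -> exp_approx b g ->
  exp_approx b (fun x => f x + g x).
Proof.
move=> [Cf fC] [Cg gC]; exists (Cf + Cg)%N => k.
have [r [B [r0 fk]]] := fC k; have [s [B' [s0 gk]]] := gC k.
exists (Num.min r s), (B + B'); rewrite lt_min r0 s0; split=> // d.
have [p [pD pf]] := fk d; have [q [qD qg]] := gk d.
exists (fun x => p x + q x); split.
  by apply: line_polyD; [apply: line_polyW pD|apply: line_polyW qD]; nia.
move=> x xb; rewrite opprD addrACA (le_trans (ncD _ _)) // mulrDl.
by apply: lerD; [apply: pf|apply: qg]; apply: polydiscW xb;
  rewrite ge_min lexx ?orbT.
Qed.

Lemma exp_approxM b f g : exp_approx b f -> exp_approx b g ->
  exp_approx b (fun x => f x * g x).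
Proof.
move=> [Cf fC] [Cg gC]; exists (Cf + Cg)%N => k.
have [r [B [r0 fk]]] := fC k; have [s [B' [s0 gk]]] := gC k.
have B0 := approx_bound_ge0 r0 fk; have B'0 := approx_bound_ge0 s0 gk.
(* The approximant for d = 0 is constant, so that f and g are bounded. *)
have [M fM] : exists M, forall x, polydisc b r x -> nc (f x) <= M.
  have [p [p0 pf]] := fk 0%N; rewrite muln0 in p0.
  exists (B + nc (p b)) => x xb; rewrite -[f x](subrK (p x)).
  rewrite (le_trans (ncD _ _)) // (line_poly0_cst p0 b x) lerD2r.
  by have := pf x xb; rewrite /rate muln0 expr0 mulr1.
have [M' gM] : exists M, forall x, polydisc b s x -> nc (g x) <= M.
  have [p [p0 pf]] := gk 0%N; rewrite muln0 in p0.
  exists (B' + nc (p b)) => x xb; rewrite -[g x](subrK (p x)).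
  rewrite (le_trans (ncD _ _)) // (line_poly0_cst p0 b x) lerD2r.
  by have := pf x xb; rewrite /rate muln0 expr0 mulr1.
exists (Num.min r s), (M * B' + (M' + B') * B); rewrite lt_min r0 s0;
  split=> // d.
have [p [pD pf]] := fk d; have [q [qD qg]] := gk d.
exists (fun x => p x * q x); split.
  by rewrite mulnDl; apply: line_polyM.
move=> x xb.
have {pf fM} pf : nc (f x - p x) <= B * rate k d /\ nc (f x) <= M.
  by split; [apply: pf|apply: fM]; apply: polydiscW xb; rewrite ge_min lexx.
have {qg gM} qg : nc (g x - q x) <= B' * rate k d /\ nc (g x) <= M'.
  by split; [apply: qg|apply: gM]; apply: polydiscW xb;
    rewrite ge_min lexx orbT.
rewrite (_ : _ - _ = f x * (g x - q x) + q x * (f x - p x)); last by ring.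
rewrite (le_trans (ncD _ _)) // !Normc.normcM mulrDl -!mulrA.
have qM : nc (q x) <= M' + B'.
  rewrite -[q x](subKr (g x)) (le_trans (ncB _ _)) // lerD ?qg.2 //.
  by rewrite (le_trans qg.1) // ler_piMr // rate_le1.
by rewrite lerD // ler_pM ?nc_ge0 ?mulr_ge0 ?rate_ge0 ?pf.1 ?pf.2 ?qg.1 ?qg.2.
Qed.

Lemma exp_approxX b f n : exp_approx b f -> exp_approx b (fun x => f x ^+ n).
Proof.
move=> gf; elim: n => [|n IHn]; first exact: exp_approx_cst.
by under [X in exp_approx _ X]eq_fun do rewrite exprS; apply: exp_approxM.
Qed.

Lemma exp_approx_sum b (I : Type) (s : seq I) (f : I -> V -> C) :
  (forall i, exp_approx b (f i)) -> exp_approx b (fun x => \sum_(i <- s) f i x).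
Proof.
move=> gf; elim: s => [|i s IHs].
  by under [X in exp_approx _ X]eq_fun do rewrite big_nil;
    apply: exp_approx_cst.
by under [X in exp_approx _ X]eq_fun do rewrite big_cons; apply: exp_approxD.
Qed.

Lemma exp_approx_prod b (I : Type) (s : seq I) (f : I -> V -> C) :
  (forall i, exp_approx b (f i)) ->
    exp_approx b (fun x => \prod_(i <- s) f i x).
Proof.
move=> gf; elim: s => [|i s IHs].
  by under [X in exp_approx _ X]eq_fun do rewrite big_nil;
    apply: exp_approx_cst.
by under [X in exp_approx _ X]eq_fun do rewrite big_cons; apply: exp_approxM.
Qed.
End Approx.

Section Identity.
Variables (R : realType) (N : nat).
Local Notation C := R[i].
Local Notation V := 'rV[C]_N.
Local Notation nc := (@Normc.normc R).
Implicit Types (a b x z v : V) (f g p : V -> C).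

Lemma rate_small (B e : R) : 0 <= B -> 0 < e -> exists d, B * 2^-1 ^+ d <= e.
Proof.
move=> B0 e0; have [n nB] : exists n : nat, B / e < n%:R.
  by exists (Num.Def.archi_bound (B / e));
    rewrite archi_boundP // divr_ge0 // ltW.
exists n; rewrite exprVn ler_pdivrMr ?exprn_gt0 // mulrC -ler_pdivrMr //.
by rewrite (le_trans (ltW nB)) // -natrX ler_nat ltnW // ltn_expl.
Qed.

Lemma exp_approx_continuous b f : exp_approx b f ->
  exists2 r : R, 0 < r & forall x, polydisc b r x -> continuous_point f x.
Proof.
move=> [Cd /(_ 1%N)[r [B [r0 fB]]]]; exists r => // x bx e e0.
have B0 := approx_bound_ge0 r0 fB.
have e4 : 0 < e / 4 by rewrite divr_gt0.
have [d dB] := rate_small B0 e4; have [p [[pc _] pf]] := fB d.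
rewrite /rate mul1n in pf.
have [s s0 ps] := pc x _ e4; have [s' s'0 bs'] := polydisc_open bx.
exists (Num.min s s'); first by rewrite lt_min s0 s'0.
move=> y xy.
have fy : nc (f y - p y) <= e / 4.
  by rewrite (le_trans _ dB) // pf //; apply: bs'; apply: polydiscW xy;
    rewrite ge_min lexx orbT.
have fx : nc (f x - p x) <= e / 4 by rewrite (le_trans _ dB) // pf.
have pyx : nc (p y - p x) < e / 4.
  by apply: ps; apply: polydiscW xy; rewrite ge_min lexx.
rewrite (_ : _ - _ = (f y - p y) + (p y - p x) - (f x - p x)); last by ring.
by have := ncB ((f y - p y) + (p y - p x)) (f x - p x);
  have := ncD (f y - p y) (p y - p x); lra.
Qed.

Lemma polydisc_line x v (rho : R) (t : C) : polydisc x (2 * rho) (x + v) ->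
  0 < rho -> nc t <= 2^-1 -> polydisc x rho (x + t *: v).
Proof.
move=> xv rho0 t2 i; have := xv i; rewrite !mxE !(addrC (x 0 i)) !addrK.
rewrite Normc.normcM; have := nc_ge0 t; have := nc_ge0 (v 0 i); nra.
Qed.

(** Let f vanish on a polydisc around x. There the d-th approximant is
    bounded by B 2^(-(Cd + 1)d), so on the polydisc of twice the radius it
    is bounded by 2 B 2^(-d), because doubling the radius costs at most the
    factor 2^(Cd d + 1) by poly_growth. As d is arbitrary, f vanishes on the
    polydisc of twice the radius. The radius is doubled until it reaches
    half of the radius r on which the approximants are close to f. *)
Lemma exp_approx_identity b f : exp_approx b f ->
  exists2 r : R, 0 < r & forall x, polydisc b r x -> germ_eq x f (fun=> 0) ->
    forall z, polydisc b r z -> f z = 0.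
Proof.
move=> [Cd /(_ Cd.+1)[r [B [r0 fB]]]].
have B0 := approx_bound_ge0 r0 fB.
have step x (rho : R) : 0 < rho -> polydisc x rho `<=` polydisc b r ->
    (forall z, polydisc x rho z -> f z = 0) ->
    forall z, polydisc x (2 * rho) z -> polydisc b r z -> f z = 0.
  move=> rho0 xb f0 z xz bz; apply: nc_eq0 => e e0.
  (* 2 for the approximant, 1 for the error of the approximation *)
  have [d dB] : exists d, (B * 3) * 2^-1 ^+ d <= e.
    by apply: rate_small => //; rewrite mulr_ge0.
  have [p [[_ pl] pf]] := fB d; apply: le_trans dB.
  have [q qs pq] := pl x (z - x).
  have q1 : nc q.[1] <= B * rate R Cd.+1 d * 2 ^+ (Cd * d).+1.
    apply: poly_growth => // t t2; rewrite -pq.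
    have xt : polydisc x rho (x + t *: (z - x)).
      by apply: polydisc_line => //; rewrite addrC subrK.
    by rewrite -ncN -[- p _]add0r -(f0 _ xt) pf //; apply: xb.
  rewrite -pq scale1r addrC subrK in q1.
  have fz := pf z bz; rewrite -[f z](subrK (p z)) (le_trans (ncD _ _)) //.
  have E : rate R Cd.+1 d * 2 ^+ (Cd * d) = 2^-1 ^+ d.
    by rewrite /rate mulSn exprD -mulrA -exprMn mulVf ?expr1n ?mulr1.
  have ge1 : 1 <= 2 ^+ (Cd * d) :> R by rewrite exprn_ege1 // ler1n.
  have gd : rate R Cd.+1 d <= 2^-1 ^+ d.
    by rewrite -E ler_peMr // rate_ge0.
  rewrite exprS [2 * _]mulrC !mulrA -(mulrA B) E in q1.
  rewrite (_ : B * 3 * _ = B * 2^-1 ^+ d + B * 2^-1 ^+ d * 2); last by ring.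
  by rewrite lerD // (le_trans fz) // ler_wpM2l.
exists (r / 4); first by rewrite divr_gt0.
move=> x bx /nbhs_polydisc[rho rho0 fx] z bz.
have xsub (s : R) : s <= r / 2 -> polydisc x s `<=` polydisc b r.
  move=> s2 w xw; apply: polydiscW (polydisc_triangle bx xw); lra.
have grow n :
    forall w, polydisc x (Num.min (2 ^+ n * rho) (r / 2)) w -> f w = 0.
  elim: n => [|n IHn] w xw.
    by apply: fx; apply: polydiscW xw; rewrite expr0 mul1r ge_min lexx.
  apply: (step x (Num.min (2 ^+ n * rho) (r / 2))) => //.
  - by rewrite lt_min mulr_gt0 ?exprn_gt0 //= divr_gt0.
  - by apply: xsub; rewrite ge_min lexx orbT.
  - apply: polydiscW xw; rewrite exprS -mulrA minr_pMr //.
    by rewrite le_min !ge_min lexx /=; apply/orP; right; lra.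
  - by apply: xsub xw; rewrite ge_min lexx orbT.
have [n nr] : exists n, (r / 2) * 2^-1 ^+ n <= rho.
  by apply: rate_small => //; rewrite divr_ge0 // ltW.
apply: (grow n); rewrite min_r; last first.
  by rewrite -ler_pdivrMl ?exprn_gt0 // mulrC -exprVn.
apply: polydiscW (polydisc_triangle (polydisc_sym bx) bz); lra.
Qed.

(** Around a point close to b where f is not zero g vanishes, hence g vanishes
    around b. *)
Lemma exp_approx_domain b f g : exp_approx b f -> exp_approx b g ->
  germ_eq b (fun x => f x * g x) (fun=> 0) ->
  germ_eq b f (fun=> 0) \/ germ_eq b g (fun=> 0).
Proof.
move=> gf gg /nbhs_polydisc[r r0 fg].
have [s s0 fc] := exp_approx_continuous gf.
have [t t0 gi] := exp_approx_identity gg.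
pose u := Num.min r (Num.min s t).
have u0 : 0 < u by rewrite !lt_min r0 s0 t0.
have [ur us ut] : [/\ u <= r, u <= s & u <= t].
  by split; rewrite /u !ge_min lexx ?orbT.
have [f0|] := pselect (forall x, polydisc b u x -> f x = 0).
  by left; apply/nbhs_polydisc; exists u.
move=> /existsNP[x /not_implyP[bx fx]]; right.
apply/nbhs_polydisc; exists t => //; apply: (gi x); first exact: polydiscW bx.
have nfx : 0 < nc (f x).
  by rewrite lt_def nc_ge0 andbT; apply/eqP => /(@Normc.eq0_normc R).
have [d d0 fd] := fc x (polydiscW us bx) _ nfx.
have [d' d'0 bd'] := polydisc_open bx.
apply/nbhs_polydisc; exists (Num.min d d'); first by rewrite lt_min d0 d'0.
move=> y xy.
have : f y * g y = 0.
  by apply: fg; apply: (polydiscW ur); apply: bd'; apply: polydiscW xy;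
    rewrite ge_min lexx orbT.
move/eqP; rewrite mulf_eq0 => /orP[/eqP fy|/eqP//].
have : nc (f y - f x) < nc (f x).
  by apply: fd; apply: polydiscW xy; rewrite ge_min lexx.
by rewrite fy sub0r ncN ltxx.
Qed.

End Identity.

(** * Convergent power series are approximable *)

Section Summable.
Variables (R : realType) (I : choiceType).
Local Notation C := R[i].
Local Notation nc := (@Normc.normc R).

(** For a finite set that contains A, the sum over A and the nonnegative
    terms is bounded, hence so is its difference with the full sum, which is
    the sum of the absolute values of the remaining terms. *)
Lemma real_sum_bounded (u : I -> R) (A : {fset I}) (K : R) :
  (forall B, fsubset A B -> `|\sum_(m <- B) u m| <= K) ->
  exists M, forall B : {fset I}, \sum_(m <- B) `|u m| <= M.
Proof.
move=> uK; exists (K + K + K + 2 * \sum_(m <- A) `|u m|) => B.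
pose T := (A `|` B)%fset.
have AT : fsubset A T by apply: fsubsetUl.
pose P m := (m \in A) || (0 <= u m).
pose T' := [fset m in T | P m]%fset.
have AT' : fsubset A T'.
  by apply/fsubsetP => m mA; rewrite !inE /= mA /P mA.
have TE F : \sum_(m <- T) F m =
    \sum_(m <- T | P m) F m + \sum_(m <- T | ~~ P m) F m :> R.
  by rewrite (bigID P).
have T'E F : \sum_(m <- T') F m = \sum_(m <- T | P m) F m :> R.
  by rewrite /T' big_fset.
have sumE (X : {fset I}) : fsubset X T ->
    \sum_(m <- X) `|u m| = \sum_(m <- T) (if m \in X then `|u m| else 0).
  move=> XT; rewrite -(big_fset_incl _ XT) => [|m _ /negbTE-> //].
  by rewrite !big_seq; apply: eq_bigr => m ->.
have BT : \sum_(m <- B) `|u m| <= \sum_(m <- T) `|u m|.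
  by rewrite sumE ?fsubsetUr //; apply: ler_sum => m _; case: ifP.
have AE := sumE _ AT.
have E1 : \sum_(m <- T | P m) `|u m| <=
    \sum_(m <- T') u m + 2 * \sum_(m <- A) `|u m|.
  rewrite T'E AE mulr_sumr.
  apply: (@le_trans _ _ (\sum_(m <- T | P m) u m +
      \sum_(m <- T | P m) 2 * (if m \in A then `|u m| else 0))).
    rewrite -big_split /=; apply: ler_sum => m; rewrite /P; case: ifP => /= _.
      by move=> _; have := ler_norm (- u m); rewrite normrN; lra.
    by move=> um; rewrite ger0_norm // mulr0 addr0.
  rewrite lerD2l [leLHS]big_mkcond /=; apply: ler_sum => m _.
  by case: (P m) => //; case: ifP => // _; rewrite ?mulr_ge0.
have E2 :
    \sum_(m <- T | ~~ P m) `|u m| = \sum_(m <- T') u m - \sum_(m <- T) u m.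
  rewrite T'E [in RHS]TE opprD addrA subrr add0r -sumrN.
  apply: eq_bigr => m; rewrite negb_or -ltNge => /andP[_ um].
  by rewrite ltr0_norm.
apply: (le_trans BT); rewrite TE E2.
have := uK _ AT; have := uK _ AT'.
by rewrite !ler_norml => /andP[_ h1] /andP[h2 _]; lra.
Qed.

Lemma Re_le_nc (z : C) : `|complex.Re z| <= nc z.
Proof. by rewrite -lecR -ncE; exact: normc_ge_Re. Qed.

Lemma Im_le_nc (z : C) : `|complex.Im z| <= nc z.
Proof.
case: z => x y; apply: le_trans (Re_le_nc (Complex y x)) _.
by rewrite /= addrC.
Qed.

Lemma nc_le_ReIm (z : C) : nc z <= `|complex.Re z| + `|complex.Im z|.
Proof.
case: z => x y /=; rewrite -[leRHS]ger0_norm ?addr_ge0 //.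
rewrite -sqrtr_sqr ler_wsqrtr //.
rewrite sqrrD !real_normK ?num_real //.
by have := mulr_ge0 (normr_ge0 x) (normr_ge0 y); lra.
Qed.

Lemma Re_sum (s : seq I) (w : I -> C) :
  complex.Re (\sum_(m <- s) w m) = \sum_(m <- s) complex.Re (w m).
Proof.
elim: s => [|m s IHs]; first by rewrite !big_nil.
by rewrite !big_cons -IHs; case: (w m) (\sum_(j <- s) w j) => ? ? [].
Qed.

Lemma Im_sum (s : seq I) (w : I -> C) :
  complex.Im (\sum_(m <- s) w m) = \sum_(m <- s) complex.Im (w m).
Proof.
elim: s => [|m s IHs]; first by rewrite !big_nil.
by rewrite !big_cons -IHs; case: (w m) (\sum_(j <- s) w j) => ? ? [].
Qed.

Lemma finite_subsets_cvgE (F : {fset I} -> C) (l : C) :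
  F @ @finite_subsets I --> l ->
  forall e : R, 0 < e -> exists A, forall B, fsubset A B -> nc (F B - l) < e.
Proof.
move=> Fl e e0.
have nl : nbhs l [set w | nc (w - l) < e].
  apply/nbhs_ballP; exists (real_complex R e); first by rewrite /= ltcR.
  by move=> w; rewrite /ball /= distrC ncE ltcR.
by have [A _ AF] := Fl _ nl; exists A => B AB; apply: AF.
Qed.

(** The bound above depends on the signs of the terms, so it is applied to the
    real and imaginary parts separately. *)
Lemma summable_bounded (w : I -> C) (l : C) :
  (fun B : {fset I} => \sum_(m <- B) w m) @ @finite_subsets I --> l ->
  exists M, forall B : {fset I}, \sum_(m <- B) nc (w m) <= M.
Proof.
move=> /finite_subsets_cvgE /(_ 1 ltr01)[A wl].
have wA B : fsubset A B -> nc (\sum_(m <- B) w m) <= 1 + nc l.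
  move=> /wl wB; rewrite -[X in nc X](subrK l) (le_trans (ncD _ _)) // lerD2r.
  exact: ltW.
have [|M1 M1P] := @real_sum_bounded (fun m => complex.Re (w m)) A (1 + nc l).
  by move=> B AB; rewrite -Re_sum (le_trans (Re_le_nc _)) // wA.
have [|M2 M2P] := @real_sum_bounded (fun m => complex.Im (w m)) A (1 + nc l).
  by move=> B AB; rewrite -Im_sum (le_trans (Im_le_nc _)) // wA.
exists (M1 + M2) => B; apply: le_trans (lerD (M1P B) (M2P B)).
by rewrite -big_split; apply: ler_sum => m _; apply: nc_le_ReIm.
Qed.
End Summable.

Section AnalyticExpApprox.
Variables (R : realType) (N : nat).
Local Notation C := R[i].
Local Notation V := 'rV[C]_N.
Local Notation nc := (@Normc.normc R).
Implicit Types (a b x z v : V) (f g p : V -> C).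

Lemma nc_prod (I : Type) (s : seq I) (F : I -> C) :
  nc (\prod_(i <- s) F i) = \prod_(i <- s) nc (F i).
Proof.
elim: s => [|i s IHs]; first by rewrite !big_nil Normc.normc1.
by rewrite !big_cons Normc.normcM IHs.
Qed.

Lemma line_poly_monomial a (m : multinom N) :
  line_poly (mdeg m) (fun x => mmap1 ((x - a) 0) m).
Proof.
rewrite mdegE.
apply: (@line_poly_prod _ _ _ _ m (fun i x => (x - a) 0 i ^+ m i)).
move=> i; rewrite -[X in line_poly X]mul1n; apply: line_polyX.
under [X in line_poly _ X]eq_fun do rewrite !mxE.
exact: line_poly_coord.
Qed.

Lemma mmap1_le (h : 'I_N -> C) (s : R) (m : multinom N) :
  (forall i, nc (h i) <= s) -> nc (mmap1 h m) <= s ^+ mdeg m.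
Proof.
move=> hs; rewrite /mmap1 nc_prod mdegE expr_sum.
apply: ler_prod => i _; rewrite ncX exprn_ge0 ?nc_ge0 //=.
have s0 : 0 <= s := le_trans (nc_ge0 _) (hs i).
by rewrite lerXn2r ?nnegrE ?nc_ge0.
Qed.

(** At the point a + (rho, ..., rho) the series converges, so that the sums of
    the |c m| rho^|m| are bounded by some M. On the polydisc of radius rho 2^-k
    the terms of total degree at least d then add up to at most M 2^(-kd). *)
Lemma analytic_exp_approx a f : analytic_at a f -> exp_approx a f.
Proof.
move=> [c /nbhs_polydisc[r r0 fc]].
pose rho := r / 2; have rho0 : 0 < rho by rewrite divr_gt0.
pose x1 : V := a + const_mx (real_complex R rho).
have x1a i : (x1 - a) 0 i = real_complex R rho.
  by rewrite /x1 addrAC subrr add0r mxE.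
have [|M MP] := summable_bounded (fc x1 _).
  move=> i; rewrite /x1 !mxE addrAC subrr add0r nc_real ?ltW //.
  by rewrite /rho; lra.
have {}MP (B : {fset multinom N}) : \sum_(m <- B) nc (c m) * rho ^+ mdeg m <= M.
  apply: le_trans (MP B); apply: ler_sum => m _; rewrite Normc.normcM.
  rewrite /mmap1 (eq_bigr (fun i => real_complex R rho ^+ m i)); last first.
    by move=> i _; rewrite x1a.
  by rewrite -expr_sum -mdegE ncX nc_real // ltW.
exists 1%N => k; exists (rho * 2^-1 ^+ k), M.
have rk0 : 0 < rho * 2^-1 ^+ k by rewrite mulr_gt0 // exprn_gt0 // invr_gt0.
split=> // d; rewrite mul1n.
pose A : {fset multinom N} :=
  seq_fset tt [seq bmnm m | m <- enum {: bmultinom N d}].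
have AE m : (m \in A) = (mdeg m < d)%N.
  rewrite seq_fsetE; apply/mapP/idP => [[b _ ->]|md]; first exact: bmdeg.
  by exists (BMultinom md); rewrite // mem_enum.
exists (fun x => \sum_(m <- A) c m * mmap1 ((x - a) 0) m); split.
  apply: line_poly_sum => m; rewrite AE => md; rewrite -[d]add0n.
  apply: line_polyM; first exact: line_poly_cst.
  by apply: line_polyW (line_poly_monomial a m); apply: ltnW.
move=> x xa; apply/ler_addgt0Pr => e e0.
have k1 : (2^-1 : R) ^+ k <= 1 by rewrite exprn_ile1 ?invr_ge0 ?invf_le1 ?ler1n.
have xr : polydisc a r x.
  by apply: polydiscW xa; apply: (@le_trans _ _ (rho * 1));
    [rewrite ler_wpM2l // ltW|rewrite /rho; lra].
have [T TP] := finite_subsets_cvgE (fc x xr) e0.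
have := TP _ (fsubsetUl T A); set B := (T `|` A)%fset => Bf.
have AB : fsubset A B by apply: fsubsetUr.
set pA := \sum_(m <- A) _.
set F := fun m => c m * mmap1 ((x - a) 0) m in pA Bf *.
rewrite (_ : _ - _ = (\sum_(m <- B) F m - pA) - (\sum_(m <- B) F m - f x));
  last by ring.
rewrite (le_trans (ncB _ _)) // lerD //; last exact: ltW.
have -> : \sum_(m <- B) F m - pA = \sum_(m <- B) (if m \in A then 0 else F m).
  rewrite /pA (_ : \sum_(m <- A) F m =
      \sum_(m <- B) (if m \in A then F m else 0)).
    by rewrite -sumrB; apply: eq_bigr => m _; case: ifP; rewrite ?subrr ?subr0.
  rewrite -(big_fset_incl _ AB) => [|m _ /negbTE-> //].
  by rewrite !big_seq; apply: eq_bigr => m ->.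
rewrite (le_trans (nc_sum _ _)) //.
rewrite (le_trans _ (ler_wpM2r (rate_ge0 _ k d) (MP B))) //.
rewrite mulr_suml; apply: ler_sum => m _; rewrite AE; case: ltnP => md.
  by rewrite Normc.normc0 !mulr_ge0 ?nc_ge0 ?rate_ge0 // exprn_ge0 // ltW.
rewrite /F Normc.normcM -mulrA ler_wpM2l ?nc_ge0 //.
have /(_ _)/le_trans := @mmap1_le ((x - a) 0) (rho * 2^-1 ^+ k) m; apply.
  by move=> i; rewrite !mxE ltW.
rewrite exprMn ler_wpM2l ?exprn_ge0 ?(ltW rho0) // /rate -exprM.
by rewrite ler_wiXn2l ?invr_ge0 ?invf_le1 ?ler1n // leq_mul2l md orbT.
Qed.

Lemma exp_approx_meval b (q : mpoly N C) :
  exp_approx b (fun x => meval (fun i => x 0 i) q).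
Proof.
under [X in exp_approx _ X]eq_fun do rewrite mevalE.
apply: exp_approx_sum => m; apply: exp_approxM; first exact: exp_approx_cst.
by apply: exp_approx_prod => i; apply: exp_approxX; apply: exp_approx_coord.
Qed.

(** The value of Q(x; Y_1, ..., Y_n) at Y = F(x). *)
Definition eval_at n (F : 'I_n -> V -> C) (x : V) : mpoly n (mpoly N C) -> C :=
  mmap (meval (fun i => x 0 i)) (fun i => F i x).

HB.instance Definition _ n F x := GRing.RMorphism.copy (@eval_at n F x)
  (mmap (meval (fun i => x 0 i)) (fun i => F i x)).

Lemma exp_approx_eval_at b n (F : 'I_n -> V -> C) (Q : mpoly n (mpoly N C)) :
  (forall i, exp_approx b (F i)) -> exp_approx b (fun x => eval_at F x Q).
Proof.
move=> gF; rewrite /eval_at /mmap; apply: exp_approx_sum => m;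
  apply: exp_approxM.
  exact: exp_approx_meval.
by apply: exp_approx_prod => i; apply: exp_approxX.
Qed.
End AnalyticExpApprox.

(** * Polynomials that vanish near a point *)

Section PolynomialGerms.
Variables (R : realType) (N : nat).
Local Notation C := R[i].
Local Notation V := 'rV[C]_N.
Local Notation nc := (@Normc.normc R).
Implicit Types (a b x z v : V) (f g p : V -> C).

Lemma poly_eq0_near (p : {poly C}) (e : R) : 0 < e ->
  (forall t, nc t < e -> p.[t] = 0) -> p = 0.
Proof.
move=> e0 pe; apply: contrapT => /eqP p0.
pose t (n : nat) : C := real_complex R (e / n.+2%:R).
have t_inj : injective t.
  move=> m n /(@complexI R) /(mulfI (lt0r_neq0 e0)) /invr_inj /eqP.
  by rewrite eqr_nat => /eqP[].
have := @max_poly_roots _ p (mkseq t (size p)) p0.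
rewrite size_mkseq ltnn => /(_ _ _)/notF; apply.
  apply/allP => _ /mapP[n _ ->]; apply/eqP/pe.
  rewrite nc_real ?divr_ge0 ?ltW // ltr_pdivrMr ?ltr0n //.
  by rewrite -[ltLHS]mulr1 ltr_pM2l // ltr1n.
by rewrite mkseq_uniq.
Qed.

Lemma digits_inj D n (c d : 'I_n -> nat) :
  (forall i, c i < D)%N -> (forall i, d i < D)%N ->
  (\sum_i c i * D ^ i = \sum_i d i * D ^ i)%N -> forall i, c i = d i.
Proof.
elim: n c d => [|n IHn] c d cD dD; first by move=> _ [].
rewrite !big_ord_recl !expn0 !muln1.
have E (h : 'I_n.+1 -> nat) : (\sum_(i < n) h (lift ord0 i) * D ^ lift ord0 i =
    (\sum_(i < n) h (lift ord0 i) * D ^ i) * D)%N.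
  by rewrite big_distrl; apply: eq_bigr => i _;
    rewrite /= /bump add1n expnSr mulnA.
rewrite !E => cd.
have c0 : c ord0 = d ord0.
  have := congr1 (modn^~ D) cd; rewrite /= ![(_ ord0 + _)%N]addnC !modnMDl.
  by rewrite !modn_small.
have D0 : (0 < D)%N by apply: leq_ltn_trans (cD ord0).
have {}cd : (\sum_(i < n) c (lift ord0 i) * D ^ i =
             \sum_(i < n) d (lift ord0 i) * D ^ i)%N.
  apply/eqP; rewrite -(eqn_pmul2r D0); apply/eqP.
  by move: cd; rewrite c0 => /addnI.
by move=> i; have [j ->|-> //] := unliftP ord0 i; apply: (IHn _ _ _ _ cd).
Qed.

(** Kronecker's substitution x_i = t^(D^i), with D greater than all exponents,
    sends distinct monomials to distinct powers of t. *)
Lemma meval_eq0_everywhere (q : mpoly N C) :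
  (forall x : V, meval (fun i => x 0 i) q = 0) -> q = 0.
Proof.
move=> q0; pose D := msize q; pose k (m : multinom N) := (\sum_i m i * D ^ i)%N.
have mD m i : m \in msupp q -> (m i < D)%N.
  move=> mq; apply: leq_ltn_trans (msize_mdeg_lt mq).
  by rewrite mdegE (bigD1 i) //= leq_addr.
pose p : {poly C} := \sum_(m <- msupp q) mcoeff m q *: 'X^(k m).
have p0 : p = 0.
  apply: (@poly_eq0_near p 1) => // t _.
  rewrite -(q0 (\row_i t ^+ (D ^ i))) mevalE horner_sum; apply: eq_bigr => m _.
  rewrite hornerZ hornerXn -prodrXr; congr (_ * _); apply: eq_bigr => i _.
  by rewrite !mxE -exprM mulnC.
apply/mpolyP => m; rewrite mcoeff0.
have [mq|/memN_msupp_eq0 //] := boolP (m \in msupp q).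
have := congr1 (fun p : {poly C} => p`_(k m)) p0.
rewrite coef0 coef_sum (bigD1_seq m) ?msupp_uniq //=.
rewrite coefZ coefXn eqxx mulr1 big_seq_cond big1 ?addr0 //
  => m' /andP[m'q m'm].
rewrite coefZ coefXn; case: eqP => [km|_]; rewrite ?mulr0 //.
case/negP: m'm; apply/eqP/mnmP => i.
by have /(_ _ _ (esym km)) -> := @digits_inj D N m' m _ _ _ i => // j;
  apply: mD.
Qed.

Lemma line_poly_meval (q : mpoly N C) :
  exists D, line_poly D (fun x : V => meval (fun i => x 0 i) q).
Proof.
exists (msize q); under [X in line_poly _ X]eq_fun do rewrite mevalE.
apply: line_poly_sum => m mq; apply: (@line_polyW _ _ (0 + mdeg m)).
  by rewrite add0n ltnW // msize_mdeg_lt.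
apply: line_polyM; first exact: line_poly_cst.
have := line_poly_monomial (0 : V) m.
by under [X in line_poly _ X -> _]eq_fun do rewrite subr0.
Qed.

Lemma meval_eq0_near b (q : mpoly N C) :
  germ_eq b (fun x => meval (fun i => x 0 i) q) (fun=> 0) -> q = 0.
Proof.
move=> /nbhs_polydisc[r r0 q0]; apply: meval_eq0_everywhere => x.
have [D [_ /(_ b (x - b))[p _ pE]]] := line_poly_meval q.
suff p0 : p = 0.
  by have := pE 1; rewrite scale1r addrC subrK => ->; rewrite p0 horner0.
pose M := 1 + \sum_i nc (x 0 i - b 0 i).
have M0 : 0 < M by rewrite ltr_wpDr ?sumr_ge0 // => i _; apply: nc_ge0.
apply: (@poly_eq0_near p (r / M)); first by rewrite divr_gt0.
move=> t tr; rewrite -pE; apply: q0 => i.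
rewrite !mxE [b 0 i + _]addrC addrK Normc.normcM.
rewrite ltr_pdivlMr // in tr; apply: le_lt_trans tr; apply: ler_wpM2l;
  first exact: nc_ge0.
rewrite /M (bigD1 i) //= addrCA lerDl addr_ge0 // sumr_ge0 // => j _;
  exact: nc_ge0.
Qed.
End PolynomialGerms.

(** * Fields of germs and permanence of relations *)

Section GermIdeal.
Variables (R : realType) (N : nat).
Local Notation C := R[i].
Local Notation V := 'rV[C]_N.
Local Notation nc := (@Normc.normc R).
Local Notation D := (mpoly N C).
Implicit Types (a b x z v : V) (f g p : V -> C).

Lemma eval_atC n (F : 'I_n -> V -> C) x (q : D) :
  eval_at F x (mpolyC n q) = meval (fun i => x 0 i) q.
Proof. exact: mmapC. Qed.

Lemma eval_atX n (F : 'I_n -> V -> C) x i :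
  eval_at F x (mpolyX D (mnm1 i)) = F i x.
Proof. by rewrite /eval_at mmapX mmap1U. Qed.

Lemma eval_at_msym n (F : 'I_n -> V -> C) x (s : 'S_n) (Q : mpoly n D) :
  eval_at F x (msym s Q) = eval_at (fun i => F (s i)) x Q.
Proof.
rewrite /msym [X in eval_at F x X]/mmap rmorph_sum; apply: eq_bigr => m _.
rewrite rmorphM /= eval_atC; congr (_ * _); rewrite rmorph_prod.
by apply: eq_bigr => i _; rewrite rmorphXn /= eval_atX.
Qed.

Lemma eval_at_horner n (F : 'I_n -> V -> C) x i (P : {poly D}) :
  eval_at F x (map_poly (@mpolyC n D) P).[mpolyX D (mnm1 i)] =
  (specialize P x).[F i x].
Proof.
rewrite -[LHS]horner_map /= eval_atX -map_poly_comp; congr (_.[_]).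
by apply: eq_map_poly => q /=; rewrite eval_atC.
Qed.

Definition germ_zero n (F : 'I_n -> V -> C) b (Q : mpoly n D) :=
  germ_eq b (fun x => eval_at F x Q) (fun=> 0).

Lemma germ_zero_congr n (F G : 'I_n -> V -> C) b Q :
  (forall i, germ_eq b (F i) (G i)) -> germ_zero F b Q -> germ_zero G b Q.
Proof.
move=> FG Fz.
have FGn := @filter_forall V _ (fun i x => F i x = G i x) (nbhs b)
  (nbhs_filter b) FG.
apply: (@filterS2 V (nbhs b) (nbhs_filter b)) FGn Fz => x FGx; rewrite /eval_at.
by rewrite (_ : (fun i => F i x) = (fun i => G i x)) //; apply/funext.
Qed.

(** The polynomial relations between the germs form a prime ideal by the
    identity theorem, in the form of exp_approx_domain. *)
Lemma germ_field n (F : 'I_n -> V -> C) b : (forall i, exp_approx b (F i)) ->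
  exists (L : fieldType) (phi : {rmorphism mpoly n D -> L}),
    (forall Q, phi Q = 0 <-> germ_zero F b Q) /\
    forall (L' : fieldType) (psi : {rmorphism mpoly n D -> L'}),
      (forall Q, psi Q = 0 <-> germ_zero F b Q) ->
      exists f : {rmorphism L -> L'}, forall Q, f (phi Q) = psi Q.
Proof.
move=> gF; apply: prime_ideal_kernel.
- by apply: (@filterE V (nbhs b) (nbhs_filter b)) => x; rewrite rmorph0.
- move=> /nbhs_singleton; rewrite rmorph1 => /eqP.
  by rewrite oner_eq0.
- move=> u v; apply: (@filterS2 V (nbhs b) (nbhs_filter b)) => x ux vx.
  by rewrite rmorphB /= ux vx subrr.
- move=> c u; apply: (@filterS V (nbhs b) (nbhs_filter b)) => x ux.
  by rewrite rmorphM /= ux mulr0.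
- move=> u v uv; apply: exp_approx_domain; try exact: exp_approx_eval_at.
  by apply: (@filterS V (nbhs b) (nbhs_filter b)) uv => x; rewrite rmorphM.
Qed.

Lemma germ_zero_eq n (F : 'I_n -> V -> C) b (L : fieldType)
    (phi : {rmorphism mpoly n D -> L}) :
  (forall Q, phi Q = 0 <-> germ_zero F b Q) ->
  forall u v : mpoly n D, phi u = phi v <->
    germ_eq b (fun x => eval_at F x u) (fun x => eval_at F x v).
Proof.
move=> phi0 u v; split=> [/eqP|uv].
  rewrite -subr_eq0 -rmorphB => /eqP/phi0.
  by apply: (@filterS V (nbhs b) (nbhs_filter b)) => x;
    rewrite rmorphB /= => /eqP; rewrite subr_eq0 => /eqP.
apply/eqP; rewrite -subr_eq0 -rmorphB; apply/eqP/phi0.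
by apply: (@filterS V (nbhs b) (nbhs_filter b)) uv => x;
  rewrite rmorphB /= => ->; rewrite subrr.
Qed.

Lemma germ_base n (F : 'I_n -> V -> C) b (L : fieldType)
    (phi : {rmorphism mpoly n D -> L}) :
  (forall Q, phi Q = 0 <-> germ_zero F b Q) ->
  exists i : {rmorphism {fraction D} -> L},
    forall q, i (tofrac q) = phi (mpolyC n q).
Proof.
move=> phi0.
have inj : injective (phi \o @mpolyC n D).
  apply: raddf_inj => q /= /phi0 q0; apply: (@meval_eq0_near _ _ b).
  by apply: (@filterS V (nbhs b) (nbhs_filter b)) q0 => x; rewrite eval_atC.
by have [i iE] := fraction_lift (f := phi \o @mpolyC n D) inj; exists i.
Qed.

(** The indicator function of the complement of A is continuous on [0, 1], and
    the intermediate value theorem applies to it. *)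
Lemma locally_constant_unit (A : R -> Prop) :
  (forall t : R, t \in `[0, 1] ->
     \forall s \near t, s \in `[0, 1] -> (A s <-> A t)) ->
  A 0 <-> A 1.
Proof.
suff aux (B : R -> Prop) : (forall t : R, t \in `[0, 1] ->
    \forall s \near t, s \in `[0, 1] -> (B s <-> B t)) -> B 0 -> B 1.
  move=> Aloc; split; first exact: aux.
  move=> A1; apply: contrapT; suff : ~ A 0 -> ~ A 1 by move=> /[apply].
  apply: (aux (fun t => ~ A t)) => t /Aloc;
    apply: (@filterS R (nbhs t) (nbhs_filter t)) => s sA sI.
  by have := sA sI; tauto.
move: B => {}A Aloc A0; apply: contrapT => A1.
pose h (t : R) : R := if `[< A t >] then 0 else 1.
have h0 : h 0 = 0 by rewrite /h; case: asboolP.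
have h1 : h 1 = 1 by rewrite /h; case: asboolP.
have hc : {within `[0, 1], continuous h}.
  apply/subspace_continuousP => t tI W /= /nbhs_singleton ht.
  change (nbhs t (fun s => [set` `[0, 1]] s -> W (h s))).
  have At := Aloc t tI.
  apply: (@filterS R (nbhs t) (nbhs_filter t)) At => s sA /sA st.
  by rewrite /h (asbool_equiv_eq st); exact: ht.
have [] := @IVT R h 0 1 2^-1 ler01 hc.
  by rewrite h0 h1 min_l ?max_r ?ler01 // invr_ge0 ler0n invf_le1 ?ler1n ?ltr0n.
move=> t _; rewrite /h; case: ifP => _ /eqP;
  first by rewrite eq_sym invr_eq0 pnatr_eq0.
by rewrite eq_sym invr_eq1 pnatr_eq1.
Qed.

(** For s close to t the germs at gam s and at gam t are germs of the same
    function, which by the identity theorem vanish together. *)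
Lemma germ_zero_continuation n (gam : R -> V) (F : 'I_n -> R -> V -> C) Q :
  {within `[0, 1], continuous gam} ->
  (forall i (t : R), t \in `[0, 1] -> analytic_at (gam t) (F i t)) ->
  (forall i (t : R), t \in `[0, 1] -> \forall s \near t, s \in `[0, 1] ->
     germ_eq (gam s) (F i s) (F i t)) ->
  germ_zero (F ^~ 0) (gam 0) Q <-> germ_zero (F ^~ 1) (gam 1) Q.
Proof.
move=> /subspace_continuousP cg Fan Fc.
apply: (@locally_constant_unit (fun t => germ_zero (F ^~ t) (gam t) Q)) => t tI.
have gt : exp_approx (gam t) (fun x => eval_at (F ^~ t) x Q).
  by apply: exp_approx_eval_at => i; apply: analytic_exp_approx; apply: Fan.
have [r r0 rP] := exp_approx_identity gt.
have near1 : \forall s \near t, s \in `[0, 1] -> polydisc (gam t) r (gam s).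
  have /(cg t tI) : nbhs (gam t) (polydisc (gam t) r).
    by apply/nbhs_polydisc; exists r.
  by rewrite /= nbhs_simpl.
have near2 := @filter_forall R _
  (fun i s => s \in `[0, 1] -> germ_eq (gam s) (F i s) (F i t))
  (nbhs t) (nbhs_filter t) (fun i => Fc i t tI).
apply: filterS2 near1 near2 => s sb sF sI.
have {}sb := sb sI.
have sE : germ_zero (F ^~ s) (gam s) Q <-> germ_zero (F ^~ t) (gam s) Q.
  split; apply: germ_zero_congr => i; first exact: sF.
  have := sF i sI.
  by apply: (@filterS V (nbhs (gam s)) (nbhs_filter _)) => x ->.
rewrite sE; split=> H.
  by apply/nbhs_polydisc; exists r => // x; apply: (rP _ sb H).
have [d d0 dr] := polydisc_open sb.
apply/nbhs_polydisc; exists d => // x /dr;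
  apply: (rP _ (polydisc_center _ r0) H).
Qed.
End GermIdeal.

(** * Monodromy and representability by radicals *)

Section Assembly.
Variables (R : realType) (N : nat).
Local Notation C := R[i].
Local Notation V := 'rV[C]_N.
Local Notation D := (mpoly N C).
Local Notation K := {fraction D}.
Implicit Types (f : V -> C).

Lemma pchar_rational : [pchar K] =i pred0.
Proof.
apply/pcharf0P => -[|n]; first by rewrite mulr0n !eqxx.
rewrite -(rmorph_nat (@tofrac D)) tofrac_eq0; apply/negbTE.
exact: mpoly_natr_neq0.
Qed.

Lemma prim_root_rational q : (0 < q)%N -> exists w : K, q.-primitive_root w.
Proof.
move=> q0; have [w wq] := prim_root_exists R q0.
exists ((@tofrac D \o @mpolyC N C) w).
by rewrite fmorph_primitive_root.
Qed.

(** By permanence, the germs y i and y (s i) satisfy the same relations.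
    Thus the permutation s of the variables preserves the prime ideal of
    relations and passes to the field L. *)
Lemma continuation_automorphism n (y : 'I_n -> V -> C) (x0 : V) (U : set V)
    (s : 'S_n) (L : fieldType) (phi : {rmorphism mpoly n D -> L})
    (i0 : {rmorphism K -> L}) :
  (forall Q, phi Q = 0 <-> germ_zero y x0 Q) ->
  (forall (L' : fieldType) (psi : {rmorphism mpoly n D -> L'}),
      (forall Q, psi Q = 0 <-> germ_zero y x0 Q) ->
      exists f : {rmorphism L -> L'}, forall Q, f (phi Q) = psi Q) ->
  (forall q, i0 (tofrac q) = phi (mpolyC n q)) ->
  (exists2 gam, loop_in U x0 gam &
     forall i, continues_to gam (y i) (y (s i))) ->
  exists f : {rmorphism L -> L}, (forall c, f (i0 c) = i0 c) /\
    forall i, f (phi (mpolyX D (mnm1 i))) = phi (mpolyX D (mnm1 (s i))).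
Proof.
move=> ker univ iE [gam [cg g0 g1 _] /choice[F FP]].
have Fan i : forall t : R, t \in `[0, 1] -> analytic_at (gam t) (F i t).
  by case: (FP i).
have Fc i : forall t : R, t \in `[0, 1] -> \forall u \near t, u \in `[0, 1] ->
    germ_eq (gam u) (F i u) (F i t).
  by case: (FP i).
have F0 i : germ_eq x0 (F i 0) (y i) by case: (FP i); rewrite g0.
have F1 i : germ_eq x0 (F i 1) (y (s i)) by case: (FP i); rewrite g1.
have sym f g : germ_eq x0 f g -> germ_eq x0 g f.
  by apply: (@filterS V (nbhs x0) (nbhs_filter x0)) => x ->.
have [|f fE] := univ L (phi \o @msym n D s).
  move=> Q; rewrite /= ker /germ_zero.
  under [X in germ_eq _ X]eq_fun do rewrite eval_at_msym.
  have := @germ_zero_continuation _ _ n gam F Q cg Fan Fc; rewrite g0 g1 => FQ.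
  split=> Z.
    apply: (germ_zero_congr F0); apply/FQ; apply: germ_zero_congr Z => i.
    exact: sym.
  apply: (@germ_zero_congr _ _ n (F ^~ 1) (fun i => y (s i)) x0 Q F1).
  by apply/FQ; apply: germ_zero_congr Z => i; apply: sym.
exists f; split=> [c|i]; last first.
  by rewrite fE /= /msym mmapX mmap1U.
have fq q : f (i0 (tofrac q)) = i0 (tofrac q).
  by rewrite iE fE /= /msym mmapC.
have [p [q [q0 cq]]] := fractionE c.
have iq0 : i0 (tofrac q) != 0 by rewrite fmorph_eq0 tofrac_eq0.
by apply: (mulIf iq0); rewrite -{1}fq -!rmorphM cq.
Qed.

Lemma radical_tower_of_germs (a : V) k (g : 'I_k -> V -> C)
    (L : fieldType) (phi : {rmorphism mpoly k D -> L})
    (i1 : {rmorphism K -> L}) :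
  (forall Q, phi Q = 0 <-> germ_zero g a Q) ->
  (forall q, i1 (tofrac q) = phi (mpolyC k q)) ->
  (forall i, radical_step a g i) ->
  radical_tower i1 (fun i => phi (mpolyX D (mnm1 i))).
Proof.
move=> ker iE step i.
have phiE u v := germ_zero_eq ker u v.
have [[p [q [qa gE]]]|[j [l [ji li gE]]]|[j [q [ji q0 gE]]]] := step i.
- apply: Or31; exists (tofrac p / tofrac q).
  have q0 : q != 0 by apply: contraNneq qa => ->; rewrite meval0.
  have iq0 : i1 (tofrac q) != 0 by rewrite fmorph_eq0 tofrac_eq0.
  apply: (mulIf iq0); rewrite -rmorphM divfK ?tofrac_eq0 // !iE -rmorphM.
  apply/phiE; have [r r0 qc] := exp_approx_continuous (exp_approx_meval a q).
  have nq : 0 < Normc.normc (meval (fun i => a 0 i) q).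
    by rewrite lt_def nc_ge0 andbT;
      apply: contraNneq qa => /(@Normc.eq0_normc R) ->.
  have [d d0 dq] := qc a (polydisc_center a r0) _ nq.
  (* As q does not vanish near a, the equation g i = p / q means g i * q = p. *)
  have qn : nbhs a (fun x => meval (fun i => x 0 i) q != 0).
    apply/nbhs_polydisc; exists d => // x /dq; apply: contraTneq => ->.
    by rewrite sub0r ncN ltxx.
  apply: (@filterS2 V (nbhs a) (nbhs_filter a)) qn gE => x qx gx.
  by rewrite rmorphM /= !eval_atC eval_atX gx divfK.
- apply: Or32; exists j, l; split=> //; case: gE => [gE|gE|gE|[l0 gE]].
  + apply: Or41; rewrite -rmorphD; apply/phiE.
    apply: (@filterS V (nbhs a) (nbhs_filter a)) gE => x.
    by rewrite rmorphD /= !eval_atX.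
  + apply: Or42; rewrite -rmorphB; apply/phiE.
    apply: (@filterS V (nbhs a) (nbhs_filter a)) gE => x.
    by rewrite rmorphB /= !eval_atX.
  + apply: Or43; rewrite -rmorphM; apply/phiE.
    apply: (@filterS V (nbhs a) (nbhs_filter a)) gE => x.
    by rewrite rmorphM /= !eval_atX.
  apply: Or44; split; last first.
    rewrite -rmorphM; apply/phiE.
    apply: (@filterS V (nbhs a) (nbhs_filter a)) gE => x.
    by rewrite rmorphM /= !eval_atX.
  apply/eqP => /ker l00; apply: l0.
  by apply: (@filterS V (nbhs a) (nbhs_filter a)) l00 => x; rewrite eval_atX.
apply: Or33; exists j, q; split=> //; rewrite -rmorphXn; apply/phiE.
apply: (@filterS V (nbhs a) (nbhs_filter a)) gE => x.
by rewrite rmorphXn /= !eval_atX.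
Qed.

Lemma root_of_germ (a : V) k (g : 'I_k -> V -> C)
    (L : fieldType) (phi : {rmorphism mpoly k D -> L})
    (i1 : {rmorphism K -> L}) (P : {poly D}) i :
  (forall Q, phi Q = 0 <-> germ_zero g a Q) ->
  (forall q, i1 (tofrac q) = phi (mpolyC k q)) ->
  germ_of P a (g i) ->
  root (map_poly i1 (map_poly (@tofrac D) P)) (phi (mpolyX D (mnm1 i))).
Proof.
move=> phi0 i1E [_ Pg]; rewrite /root -map_poly_comp.
rewrite (eq_map_poly (g := phi \o @mpolyC k D)) => [|q]; last by rewrite /= i1E.
rewrite map_poly_comp horner_map; apply/eqP/phi0.
by apply: (@filterS V (nbhs a) (nbhs_filter a)) Pg => x; rewrite eval_at_horner.
Qed.
End Assembly.

Theorem theorem15 (R : realType) (N : nat) (P : {poly mpoly N R[i]})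
    (hP : irreducible_equation P)
    (x0 : 'rV[R[i]]_N) (hx0 : ~ singular_locus P x0)
    (y : 'I_(degree P) -> 'rV[R[i]]_N -> R[i]) (hy : all_germs_of P x0 y) :
  ~~ solvable (monodromy_group P x0 y) -> ~ representable_by_radicals P.
Proof.
move=> /negP unsolvable [a [k [g [ga gstep gP]]]]; apply: unsolvable.
have [yP yinj _] := hy.
have [L0 [phi0 [ker0 univ0]]] :=
  germ_field (fun i => analytic_exp_approx (proj1 (yP i))).
have [i0 i0E] := germ_base ker0.
have [L1 [phi1 [ker1 _]]] := germ_field (fun i => analytic_exp_approx (ga i)).
have [i1 i1E] := germ_base ker1.
pose G := Group (monodromy_group_set hx0 hy).
rewrite -[monodromy_group _ _ _]/(gval G).
apply: (@solvable_of_radical_tower _ (map_poly (@tofrac _) P) L0 i0 _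
  (fun i => phi0 (mpolyX _ (mnm1 i))) G L1 i1 k (fun i => phi1 (mpolyX _ (mnm1
    i)))).
- exact: pchar_rational.
- exact: prim_root_rational.
- exact: hP.
- move=> i j /(germ_zero_eq ker0) ij; apply: yinj.
  by apply: (@filterS _ (nbhs x0) (nbhs_filter x0)) ij => x; rewrite !eval_atX.
- by move=> i; apply: root_of_germ ker0 i0E (yP i).
- move=> s /monodromy_groupP; exact: continuation_automorphism ker0 univ0 i0E.
- exact: radical_tower_of_germs ker1 i1E gstep.
- exact: root_of_germ ker1 i1E gP.
Qed.
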